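(* Let $K$ be a field, let $R$ be a finite-dimensional $K$-algebra, let $n\geq 2$ be an integer, and let $\varphi:(R^* )^{\otimes_R n}\to R$ be an associative morphism of $R$-bimodules. The following hold. (i) If $(R^* )^{\otimes_R(n-2)}\simeq R$ as $R$-bimodules, then $A(R,R^*,\varphi)$ is a symmetric algebra. (ii) If $R$ is a Frobenius algebra, then $A(R,R^*,\varphi)$ is $\widehat{n-1}$-graded Frobenius, in particular it is a Frobenius algebra. Moreover, if $\lambda$ is a Frobenius form on $R$, with associated Nakayama automorphism $\nu$, then the linear map $\Lambda:A(R,R^*,\varphi)\to K$ such that $$\Lambda\big((r_1\rightharpoonup\lambda)\otimes_R\cdots\otimes_R(r_{n-1}\rightharpoonup\lambda)\big)=\lambda\big(r_1\nu(r_2)\cdots\nu^{n-2}(r_{n-1})\big)$$ for any $r_1,\ldots,r_{n-1}\in R$, and $\Lambda$ vanishes on any homogeneous component of degree $\neq\widehat{n-1}$ of $A(R,R^*,\varphi)$, is a Frobenius form on $A(R,R^*,\varphi)$, and the Nakayama automorphism $\mathcal{N}$ of $A(R,R^*,\varphi)$ associated with $\Lambda$ is given by $$\mathcal{N}\big((r_1\rightharpoonup\lambda)\otimes_R\cdots\otimes_R(r_i\rightharpoonup\lambda)\big)=(\nu^{2-n}(r_1)\rightharpoonup\lambda)\otimes_R\cdots\otimes_R(\nu^{2-n}(r_i)\rightharpoonup\lambda)$$ for any $1\leq i\leq n-1$ and any $r_1,\ldots,r_i\in R$, and $\mathcal{N}(r)=\nu^{2-n}(r)$ for any $r\in R$.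
   Context: All algebras, vector spaces and linear duals are over $K$; for a finite-dimensional algebra $B$, $B^*=\mathrm{Hom}_K(B,K)$ is a $B$-bimodule via $(r\rightharpoonup r^* )(s)=r^*(sr)$ and $(r^*\leftharpoonup r)(s)=r^*(rs)$. Convention: $M^{\otimes_R 0}=R$, $M^{\otimes_R 1}=M$. For an $R$-bimodule $M$, a bimodule morphism $\varphi:M^{\otimes_R n}\to R$ is associative if $\varphi(m_1\otimes_R\cdots\otimes_R m_n)m_{n+1}=m_1\varphi(m_2\otimes_R\cdots\otimes_R m_{n+1})$ for all $m_1,\ldots,m_{n+1}\in M$. For associative $\varphi$, $A(R,M,\varphi)$ is the factor algebra of the tensor algebra $T_R(M)=\bigoplus_{i\geq 0}M^{\otimes_R i}$ by the two-sided ideal generated by all elements $m_1\otimes_R\cdots\otimes_R m_n-\varphi(m_1\otimes_R\cdots\otimes_R m_n)$. It is identified with $R\oplus M\oplus\cdots\oplus M^{\otimes_R(n-1)}$, where the multiplication is tensor concatenation if the total length is less than $n$, and otherwise concatenation followed by applying $\varphi$ to $n$ successive tensor positions (the choice is irrelevant by associativity). It is $\mathbb{Z}_n$-graded, with homogeneous component of degree $\hat{i}$ equal to $M^{\otimes_R i}$ for $0\leq i\leq n-1$, where $\hat{i}$ is the class of $i$ modulo $n$. Here $M=R^*$. A finite-dimensional algebra $B$ is Frobenius if $B^*\simeq B$ as left $B$-modules, and symmetric if $B^*\simeq B$ as $B$-bimodules. A Frobenius form on $B$ is $\lambda\in B^*$ with $B\rightharpoonup\lambda=B^*$; $B$ is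 Frobenius if and only if it has one. The Nakayama automorphism of $B$ associated with a Frobenius form $\lambda$ is the unique map $\nu:B\to B$ with $\lambda\leftharpoonup r=\nu(r)\rightharpoonup\lambda$ for all $r\in B$; it is an algebra automorphism. For a finite-dimensional algebra $A$ graded by a group $G$ and $\sigma\in G$: $A^*$ is graded by $(A^* )_g=\{a^*\in A^* : a^*(A_h)=0\text{ for all }h\neq g^{-1}\}$, $A(\sigma)$ is the left $A$-module $A$ with grading $A(\sigma)_g=A_{g\sigma}$, and $A$ is $\sigma$-graded Frobenius if $A^*\simeq A(\sigma)$ as graded left $A$-modules. Here $G=\mathbb{Z}_n$ (additive). *)

(* Defs.v *)
From HB Require Import structures.
From mathcomp Require Import all_boot all_order all_algebra all_field.

Set Implicit Arguments.
Unset Strict Implicit.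
Unset Printing Implicit Defensive.

Import GRing.Theory.
Local Open Scope ring_scope.

Section LinearFacts.

Variables (K : fieldType) (X Y : lmodType K) (f : X -> Y) (fL : linear f).

Lemma lin0 : f 0 = 0.
Proof. by have := fL (-1) 0 0; rewrite addr0 scaler0 scaleN1r addNr. Qed.

Lemma linD u v : f (u + v) = f u + f v.
Proof. by rewrite -[u in LHS]scale1r fL scale1r. Qed.

Lemma linZ a u : f (a *: u) = a *: f u.
Proof. by rewrite -[a *: u]addr0 fL lin0 addr0. Qed.

Lemma linB u v : f (u - v) = f u - f v.
Proof. by rewrite -[- v]scaleN1r linD linZ scaleN1r. Qed.

Lemma lin_sum (I : Type) (s : seq I) (P : pred I) (x : I -> X) :
  f (\sum_(i <- s | P i) x i) = \sum_(i <- s | P i) f (x i).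
Proof. exact: (big_morph f linD lin0). Qed.

Lemma lin_comb (I : Type) (s : seq I) (c : I -> K) (x : I -> X) :
  f (\sum_(i <- s) c i *: x i) = \sum_(i <- s) c i *: f (x i).
Proof. by rewrite lin_sum; apply: eq_bigr => i _; rewrite linZ. Qed.

End LinearFacts.

Section LinearClosure.

Variables (K : fieldType) (X Y Z : lmodType K).

Lemma lin_comp (f : X -> Y) (g : Y -> Z) :
  linear f -> linear g -> linear (fun x => g (f x)).
Proof. by move=> fL gL a x y; rewrite fL gL. Qed.

Lemma lin_addZ (f g : X -> Y) a :
  linear f -> linear g -> linear (fun x => a *: f x + g x).
Proof.
move=> fL gL b x y; rewrite fL gL !scalerDr !scalerA mulrC -!addrA.
by congr (_ + _); rewrite addrCA.
Qed.

End LinearClosure.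

Section Quotient.

Variables (K : fieldType) (V : vectType K) (W : {vspace V}).

(* The quotient space V / W, realised on a complement of W. *)
Definition quot : vectType K := subvs_of (W^C)%VS.

Definition qproj (v : V) : quot := vsproj (W^C)%VS (daddv_pi (W^C)%VS W v).

Lemma qproj_linear : linear qproj.
Proof. by move=> a u v; rewrite /qproj !linearP. Qed.

Lemma qval_linear : linear (fun q : quot => vsval q).
Proof. by move=> a q q'; apply: (linearP (@vsval K V (W^C)%VS)). Qed.

Lemma qprojK (q : quot) : qproj (vsval q) = q.
Proof.
rewrite /qproj daddv_pi_id ?vsvalK ?subvsP //.
by rewrite capvC capv_compl.
Qed.

Lemma qproj_sub v : v - vsval (qproj v) \in W.
Proof.
rewrite /qproj vsprojK ?memv_pi //.
have E : (W^C :&: W = 0)%VS by rewrite capvC capv_compl.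
have := @daddv_pi_add _ _ _ _ v E.
rewrite addvC addv_complf memvf => /(_ isT) {1}<-.
by rewrite addrAC subrr add0r memv_pi.
Qed.

Lemma qproj0 w : w \in W -> qproj w = 0.
Proof.
move=> Ww; apply: val_inj; rewrite /= -[vsval _]/(vsval (qproj w)).
have m1 : vsval (qproj w) \in W.
  have := memvB Ww (qproj_sub w).
  by rewrite opprB addrC subrK.
have m2 : vsval (qproj w) \in (W^C)%VS by apply: subvsP.
apply/eqP; rewrite -memv0 -(capv_compl W) memv_cap m1 //=.
Qed.

End Quotient.

Section Bimodules.

Variables (K : fieldType) (R : falgType K).

Record bimodule := Bimodule {
  bmod :> vectType K;
  lact : R -> bmod -> bmod;
  ract : bmod -> R -> bmod;
  lact_linearl : forall u, linear (lact^~ u);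
  lact_linearr : forall r, linear (lact r);
  ract_linearl : forall r, linear (ract^~ r);
  ract_linearr : forall u, linear (ract u);
  lact1 : forall u, lact 1 u = u;
  ract1 : forall u, ract u 1 = u;
  lactA : forall r s u, lact (r * s) u = lact r (lact s u);
  ractA : forall u r s, ract u (r * s) = ract (ract u r) s;
  lractA : forall r u s, ract (lact r u) s = lact r (ract u s)
}.

Definition bimod_morph (U V : bimodule) (f : U -> V) : Prop :=
  [/\ linear f,
      forall r u, f (lact r u) = lact r (f u)
    & forall u r, f (ract u r) = ract (f u) r].

Definition bimod_iso (U V : bimodule) : Prop :=
  exists2 f : U -> V, bimod_morph f & bijective f.

Section Regular.

Let regl (r u : R) : R := r * u.
Let regr (u r : R) : R := u * r.

Definition reg_bimod : bimodule.
Proof.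
refine (@Bimodule R regl regr _ _ _ _ _ _ _ _ _); rewrite /regl /regr.
- by move=> u a v w; rewrite mulrDl scalerAl.
- by move=> u a v w; rewrite mulrDr scalerAr.
- by move=> u a v w; rewrite mulrDl scalerAl.
- by move=> u a v w; rewrite mulrDr scalerAr.
- exact: mul1r.
- exact: mulr1.
- by move=> r s u; rewrite mulrA.
- by move=> r s u; rewrite mulrA.
- by move=> r s u; rewrite mulrA.
Defined.

End Regular.

Section Dual.

Definition dual : vectType K := 'Hom(R, K^o).

Definition dual_lact (r : R) (f : dual) : dual := (f \o amulr r)%VF.
Definition dual_ract (f : dual) (r : R) : dual := (f \o amull r)%VF.

Lemma dual_lactE r f s : dual_lact r f s = f (s * r).
Proof. by rewrite /dual_lact comp_lfunE lfunE. Qed.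

Lemma dual_ractE f r s : dual_ract f r s = f (r * s).
Proof. by rewrite /dual_ract comp_lfunE lfunE. Qed.

Definition dual_bimod : bimodule.
Proof.
refine (@Bimodule dual dual_lact dual_ract _ _ _ _ _ _ _ _ _).
- move=> f a r s; apply/lfunP => x.
  by rewrite add_lfunE scale_lfunE !dual_lactE mulrDr -scalerAr linearP.
- move=> r a f g; apply/lfunP => x.
  by rewrite !(dual_lactE, add_lfunE, scale_lfunE).
- move=> r a f g; apply/lfunP => x.
  by rewrite !(dual_ractE, add_lfunE, scale_lfunE).
- move=> f a r s; apply/lfunP => x.
  by rewrite add_lfunE scale_lfunE !dual_ractE mulrDl -scalerAl linearP.
- by move=> f; apply/lfunP => x; rewrite dual_lactE mulr1.
- by move=> f; apply/lfunP => x; rewrite dual_ractE mul1r.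
- by move=> r s f; apply/lfunP => x; rewrite !dual_lactE mulrA.
- by move=> f r s; apply/lfunP => x; rewrite !dual_ractE mulrA.
- by move=> r f s; apply/lfunP => x; rewrite !(dual_ractE, dual_lactE) mulrA.
Defined.

End Dual.

Section Tensor.

Variables U V : bimodule.

Local Notation eU := (vbasis {:U}).
Local Notation eV := (vbasis {:V}).
Local Notation eR := (vbasis {:R}).

Definition ktens (u : U) (v : V) : 'M[K]_(\dim {:U}, \dim {:V}) :=
  \matrix_(i, j) (coord eU i u * coord eV j v).

(* By trilinearity, the relations u r (x) v - u (x) r v for u, r, v in the
   chosen bases span all the others. *)
Definition tensor_rel : {vspace 'M[K]_(\dim {:U}, \dim {:V})} :=
  (\sum_(i < \dim {:U}) \sum_(k < \dim {:R}) \sum_(j < \dim {:V})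
     <[ktens (ract eU`_i eR`_k) eV`_j - ktens eU`_i (lact eR`_k eV`_j)]>)%VS.

Definition tensor_space : vectType K := quot tensor_rel.

Definition tens (u : U) (v : V) : tensor_space := qproj tensor_rel (ktens u v).

Definition balanced (X : lmodType K) (f : U -> V -> X) : Prop :=
  [/\ forall v, linear (f^~ v), forall u, linear (f u)
    & forall u r v, f (ract u r) v = f u (lact r v)].

Definition tlift (X : lmodType K) (f : U -> V -> X) (t : tensor_space) : X :=
  \sum_(i < \dim {:U}) \sum_(j < \dim {:V}) (vsval t) i j *: f eU`_i eV`_j.

Lemma ktens_linearl v : linear (ktens^~ v).
Proof.
by move=> a u u'; apply/matrixP => i j; rewrite !mxE linearP mulrDl /= mulrA.
Qed.

Lemma ktens_linearr u : linear (ktens u).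
Proof.
move=> a v v'; apply/matrixP => i j; rewrite !mxE linearP mulrDr /=.
by rewrite mulrCA.
Qed.

Lemma klift_ktens (X : lmodType K) (f : U -> V -> X) u v :
  (forall v, linear (f^~ v)) -> (forall u, linear (f u)) ->
  \sum_(i < \dim {:U}) \sum_(j < \dim {:V})
     (ktens u v) i j *: f eU`_i eV`_j = f u v.
Proof.
move=> fl fr.
rewrite [in RHS](coord_vbasis (memvf u)) (lin_comb (fl v)).
apply: eq_bigr => i _.
rewrite [in RHS](coord_vbasis (memvf v)) (lin_comb (fr _)) scaler_sumr.
by apply: eq_bigr => j _; rewrite mxE scalerA.
Qed.

Lemma ktens_rel u r v :
  ktens (ract u r) v - ktens u (lact r v) \in tensor_rel.
Proof.
pose g u r v := ktens (ract u r) v - ktens u (lact r v).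
have gl r' v' : linear (fun u => g u r' v').
  move=> a x y; rewrite /g ract_linearl !ktens_linearl scalerBr opprD.
  by rewrite -!addrA; congr (_ + _); rewrite addrCA.
have gr u' v' : linear (fun r => g u' r v').
  move=> a x y; rewrite /g ract_linearr lact_linearl.
  rewrite ktens_linearl ktens_linearr scalerBr opprD.
  by rewrite -!addrA; congr (_ + _); rewrite addrCA.
have gv u' r' : linear (fun v => g u' r' v).
  move=> a x y; rewrite /g lact_linearr !ktens_linearr scalerBr opprD.
  by rewrite -!addrA; congr (_ + _); rewrite addrCA.
rewrite -/(g u r v) (coord_vbasis (memvf u)) (lin_comb (gl r v)).
rewrite /tensor_rel; apply: memv_sumr => i _.
rewrite memvZ // {1}(coord_vbasis (memvf r)) (lin_comb (gr _ v)).
apply: memv_sumr => k _.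
rewrite memvZ // {1}(coord_vbasis (memvf v)) (lin_comb (gv _ _)).
apply: memv_sumr => j _.
by rewrite memvZ // memv_line.
Qed.

Lemma tens_balanced : balanced tens.
Proof.
split=> [v a u u'|u a v v'|u r v]; rewrite /tens.
- by rewrite ktens_linearl qproj_linear.
- by rewrite ktens_linearr qproj_linear.
apply/eqP; rewrite -subr_eq0 -(linB (@qproj_linear _ _ _)).
by rewrite qproj0 // ktens_rel.
Qed.

Lemma tlift_linear (X : lmodType K) (f : U -> V -> X) : linear (tlift f).
Proof.
move=> a s t; rewrite /tlift scaler_sumr -big_split; apply: eq_bigr => i _.
rewrite scaler_sumr -big_split; apply: eq_bigr => j _ /=.
by rewrite !mxE scalerDl scalerA.
Qed.

Lemma tlift_tens (X : lmodType K) (f : U -> V -> X) :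
  balanced f -> forall u v, tlift f (tens u v) = f u v.
Proof.
move=> [fl fr fb] u v; rewrite -(klift_ktens u v fl fr) /tlift.
pose F (m : 'M[K]_(\dim {:U}, \dim {:V})) : X :=
  \sum_(i < \dim {:U}) \sum_(j < \dim {:V}) m i j *: f eU`_i eV`_j.
rewrite -/(F _) -/(F (ktens u v)).
have FL : linear F.
  move=> a s t; rewrite /F scaler_sumr -big_split; apply: eq_bigr => i _.
  rewrite scaler_sumr -big_split; apply: eq_bigr => j _ /=.
  by rewrite !mxE scalerDl scalerA.
have Fk x y : F (ktens x y) = f x y by apply: klift_ktens.
have FW m : m \in tensor_rel -> F m = 0.
  rewrite /tensor_rel.
  case/memv_sumP=> m1 m1P ->; rewrite (lin_sum FL) big1 // => i _.
  case/memv_sumP: (m1P i isT) => m2 m2P ->.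
  rewrite (lin_sum FL) big1 // => k _.
  case/memv_sumP: (m2P k isT) => m3 m3P ->.
  rewrite (lin_sum FL) big1 // => j _.
  case/vlineP: (m3P j isT) => c ->.
  by rewrite (linZ FL) (linB FL) !Fk fb subrr scaler0.
apply/esym/eqP; rewrite -subr_eq0 -(linB FL); apply/eqP/FW.
exact: qproj_sub.
Qed.

Lemma tens_ind (X : lmodType K) (f g : tensor_space -> X) :
  linear f -> linear g -> (forall u v, f (tens u v) = g (tens u v)) ->
  f =1 g.
Proof.
move=> fL gL fg t.
have E : t = \sum_(p : 'I_(\dim {:U}) * 'I_(\dim {:V}))
    (vsval t) p.1 p.2 *: tens eU`_p.1 eV`_p.2.
  rewrite -[t in LHS](qprojK t).
  transitivity (qproj tensor_rel (\sum_(p : 'I_(\dim {:U}) * 'I_(\dim {:V}))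
    (vsval t) p.1 p.2 *: ktens eU`_p.1 eV`_p.2)); last first.
    exact: (lin_comb (@qproj_linear _ _ tensor_rel)).
  congr (qproj _ _); rewrite -(pair_bigA _ (fun i j => (vsval t) i j *: ktens eU`_i eV`_j)) /=.
  rewrite [LHS]matrix_sum_delta; apply: eq_bigr => i _; apply: eq_bigr => j _.
  congr (_ *: _); apply/matrixP => i' j'; rewrite !mxE.
  rewrite !coord_free ?(basis_free (vbasisP _)) // -natrM mulnb.
  by rewrite [i' == i]eq_sym [j' == j]eq_sym.
rewrite E (lin_comb fL) (lin_comb gL).
by apply: eq_bigr => p _; rewrite fg.
Qed.


Section Actions.

Let tl (r : R) (t : tensor_space) : tensor_space :=
  tlift (fun u v => tens (lact r u) v) t.
Let tr (t : tensor_space) (r : R) : tensor_space :=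
  tlift (fun u v => tens u (ract v r)) t.

Let tlE r u v : tl r (tens u v) = tens (lact r u) v.
Proof.
have [bl br bb] := tens_balanced.
apply: tlift_tens; split=> [v' a x y|u' a x y|x s y].
- by rewrite lact_linearr bl.
- by rewrite br.
- by rewrite -lractA bb.
Qed.

Let trE u v r : tr (tens u v) r = tens u (ract v r).
Proof.
have [bl br bb] := tens_balanced.
apply: tlift_tens; split=> [v' a x y|u' a x y|x s y].
- by rewrite bl.
- by rewrite ract_linearl br.
- by rewrite lractA bb.
Qed.

Let tlL r : linear (tl r). Proof. exact: tlift_linear. Qed.

Let trL r : linear (tr^~ r). Proof. exact: tlift_linear. Qed.

Let tlift_param (f : R -> U -> V -> tensor_space) t :
  (forall u v, linear (fun r => f r u v)) -> linear (fun r => tlift (f r) t).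
Proof.
move=> fL a r s; rewrite /tlift scaler_sumr -big_split; apply: eq_bigr => i _.
rewrite scaler_sumr -big_split; apply: eq_bigr => j _ /=.
by rewrite fL scalerDr !scalerA mulrC.
Qed.

Let tlLl t : linear (tl^~ t).
Proof.
apply: tlift_param => u v a r s; have [bl _ _] := tens_balanced.
by rewrite lact_linearl bl.
Qed.

Let trLr t : linear (tr t).
Proof.
apply: (@tlift_param (fun r u v => tens u (ract v r))) => u v a r s.
by have [_ br _] := tens_balanced; rewrite ract_linearr br.
Qed.

Let tl1 t : tl 1 t = t.
Proof. by move: t; apply: tens_ind => // u v; rewrite tlE lact1. Qed.

Let tr1 t : tr t 1 = t.
Proof.
by move: t; apply: (@tens_ind _ (tr^~ 1)) => // u v; rewrite trE ract1.
Qed.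

Let tlA r s t : tl (r * s) t = tl r (tl s t).
Proof.
move: t; apply: tens_ind => // [a x y|u v]; first by rewrite !tlL.
by rewrite !tlE lactA.
Qed.

Let trA t r s : tr t (r * s) = tr (tr t r) s.
Proof.
move: t; apply: (@tens_ind _ (tr^~ (r * s)) (fun t => tr (tr t r) s)) => //.
  by move=> a x y; rewrite !trL.
by move=> u v; rewrite !trE ractA.
Qed.

Let tlrA r t s : tr (tl r t) s = tl r (tr t s).
Proof.
move: t.
apply: (@tens_ind _ (fun t => tr (tl r t) s) (fun t => tl r (tr t s))).
- by move=> a x y; rewrite tlL trL.
- by move=> a x y; rewrite trL tlL.
- by move=> u v; rewrite tlE !trE tlE.
Qed.

Definition tensor : bimodule :=
  @Bimodule tensor_space tl tr tlLl tlL trL trLr tl1 tr1 tlA trA tlrA.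

Lemma lact_tens r u v : lact (b := tensor) r (tens u v) = tens (lact r u) v.
Proof. exact: tlE. Qed.

Lemma ract_tens u v r : ract (b := tensor) (tens u v) r = tens u (ract v r).
Proof. exact: trE. Qed.

End Actions.

End Tensor.

Section TensorPowers.

Variable M : bimodule.

Fixpoint tpow (i : nat) : bimodule :=
  match i with
  | 0 => reg_bimod
  | 1 => M
  | (_.+1 as j).+1 => tensor M (tpow j)
  end.

(* m (x) t, with M (x)_R R identified with M *)
Definition tcons (i : nat) (m : M) : tpow i -> tpow i.+1 :=
  match i with
  | 0 => fun r => ract m r
  | i'.+1 => fun t => @tens M (tpow i'.+1) m t
  end.

Fixpoint tprod (i : nat) : ('I_i -> M) -> tpow i :=
  match i with
  | 0 => fun _ => (1 : R)
  | i'.+1 => fun m => tcons (m ord0) (tprod (fun k => m (lift ord0 k)))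
  end.

Definition tcons_lift (X : lmodType K) (i : nat) :
    (M -> tpow i -> X) -> tpow i.+1 -> X :=
  match i with
  | 0 => fun f m => f m (1 : R)
  | i'.+1 => fun f t => @tlift M (tpow i'.+1) X f t
  end.

Fixpoint tcat (i j : nat) : tpow i -> tpow j -> tpow (i + j) :=
  match i with
  | 0 => fun r y => lact r y
  | i'.+1 => fun x y => tcons_lift (fun m t => tcons m (tcat t y)) x
  end.

(* psi applied to the first n tensor positions:
   contr psi (x (x) y) = psi x . y for x of length n and y of length k. *)
Fixpoint contr (n k : nat) : (tpow n -> R) -> tpow (n + k) -> tpow k :=
  match n with
  | 0 => fun psi z => lact (psi (1 : R)) z
  | n'.+1 => fun psi z =>
      tcons_lift (fun m t => contr (fun x => psi (tcons m x)) t) z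
  end.

(* The identity if i = j, and 0 otherwise. *)
Definition tconv (i j : nat) (x : tpow i) : tpow j :=
  if eqP is ReflectT e then ecast j (tpow j) e x else 0.

Lemma tconv_id i (x : tpow i) : tconv i x = x.
Proof. by rewrite /tconv; case: eqP => // e; rewrite (eq_irrelevance e erefl). Qed.

Lemma tconv_neq i j (x : tpow i) : i != j -> tconv j x = 0.
Proof. by rewrite /tconv; case: eqP. Qed.

Lemma tconv_linear i j : linear (@tconv i j).
Proof.
have [<-|ij] := eqVneq i j; first by move=> a x y; rewrite !tconv_id.
by move=> a x y; rewrite !tconv_neq // scaler0 addr0.
Qed.

Lemma tconv_trans i j k (x : tpow i) :
  i = j -> tconv k (tconv j x) = tconv k x.
Proof. by move=> e; case: j / e; rewrite tconv_id. Qed.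

Lemma tcons_balanced i : balanced (@tcons i).
Proof.
case: i => [|i]; last exact: tens_balanced.
split=> [v a x y|u a x y|u r v] /=.
- by rewrite ract_linearl.
- by rewrite ract_linearr.
- by rewrite -ractA.
Qed.

Lemma tcons_liftE (X : lmodType K) i (f : M -> tpow i -> X) :
  balanced f -> forall m t, tcons_lift f (tcons m t) = f m t.
Proof.
case: i f => [|i] f fb m t /=; last exact: tlift_tens.
by case: fb => _ _ ->; rewrite /= mulr1.
Qed.

Lemma tcons_lift_linear (X : lmodType K) i (f : M -> tpow i -> X) :
  (forall t, linear (f^~ t)) -> linear (tcons_lift f).
Proof. by case: i f => [|i] f fl; [apply: fl | apply: tlift_linear]. Qed.

Lemma tcons_ind (X : lmodType K) i (f g : tpow i.+1 -> X) :
  linear f -> linear g -> (forall m t, f (tcons m t) = g (tcons m t)) ->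
  f =1 g.
Proof.
case: i f g => [|i] f g fL gL fg; last exact: tens_ind.
by move=> m; have := fg m (1 : R); rewrite /= ract1.
Qed.

Lemma lact_tcons i r m (t : tpow i) :
  lact r (tcons m t) = tcons (lact r m) t.
Proof. by case: i t => [|i] t; [rewrite /= -lractA | apply: lact_tens]. Qed.

Lemma ract_tcons i m (t : tpow i) r :
  ract (tcons m t) r = tcons m (ract t r).
Proof. by case: i t => [|i] t; [rewrite /= -ractA | apply: ract_tens]. Qed.

Lemma tcons_conv i j m (x : tpow i) :
  i = j -> tcons m (tconv j x) = tconv j.+1 (tcons m x).
Proof. by move=> e; case: j / e; rewrite !tconv_id. Qed.

Lemma tcons_lift_ext (X : lmodType K) i (f g : M -> tpow i -> X) :
  (forall m t, f m t = g m t) -> tcons_lift f =1 tcons_lift g.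
Proof.
case: i f g => [|i] f g fg x /=; first exact: fg.
by apply: eq_bigr => k _; apply: eq_bigr => j _; rewrite fg.
Qed.

Lemma tcons_lift_comp (X Y : lmodType K) i (h : X -> Y) (f : M -> tpow i -> X) :
  linear h -> forall x, tcons_lift (fun m t => h (f m t)) x = h (tcons_lift f x).
Proof.
case: i f => [|i] f hL x //=; rewrite /tlift (lin_sum hL).
by apply: eq_bigr => k _; rewrite (lin_comb hL).
Qed.

Lemma tcons_lift_comb (X : lmodType K) i (f g : M -> tpow i -> X) a x :
  tcons_lift (fun m t => a *: f m t + g m t) x =
  a *: tcons_lift f x + tcons_lift g x.
Proof.
case: i f g x => [|i] f g x //=; rewrite /tlift scaler_sumr -big_split.
apply: eq_bigr => k _; rewrite scaler_sumr -big_split; apply: eq_bigr => j _ /=.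
by rewrite scalerDr !scalerA mulrC.
Qed.

Lemma tcat_linearl i j (y : tpow j) : linear (fun x : tpow i => tcat x y).
Proof.
case: i => [|i] /=; first exact: lact_linearl.
by apply: tcons_lift_linear => t; have [tl _ _] := tcons_balanced (i + j).
Qed.

Lemma tcat_bal i j (y : tpow j) :
  (forall r (x : tpow i), tcat (lact r x) y = lact r (tcat x y)) ->
  balanced (fun m (t : tpow i) => tcons m (tcat t y)).
Proof.
move=> H; have [tl tr tb] := tcons_balanced (i + j).
split=> [t|m|m r t]; first exact: tl.
  exact: lin_comp (@tcat_linearl _ _ _) (tr m).
by rewrite tb H.
Qed.

Lemma tcat_lact i j r (x : tpow i) (y : tpow j) :
  tcat (lact r x) y = lact r (tcat x y).
Proof.
elim: i r x => [|i IH] r x; first by rewrite /= lactA.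
move: x; apply: tcons_ind.
- by apply: lin_comp (@tcat_linearl _ _ _); apply: lact_linearr.
- exact: lin_comp (@tcat_linearl _ _ _) (lact_linearr _).
move=> m t; rewrite lact_tcons /=.
have B := tcat_bal IH.
by rewrite !(tcons_liftE B) -[RHS]/(lact r (tcons _ _)) lact_tcons.
Qed.

Lemma tcat_tcons i j m (t : tpow i) (y : tpow j) :
  tcat (tcons m t) y = tcons m (tcat t y).
Proof.
by rewrite /= (tcons_liftE (tcat_bal (fun r (x : tpow i) => tcat_lact r x y))).
Qed.

Lemma tcat_linearr i j (x : tpow i) : linear (@tcat i j x).
Proof.
move=> a y z; elim: i x => [|i IH]; first by move=> x; apply: lact_linearr.
apply: tcons_ind; first exact: tcat_linearl.
  by apply: lin_addZ; apply: tcat_linearl.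
move=> m t; rewrite !tcat_tcons IH.
by have [_ tr _] := tcons_balanced (i + j); rewrite tr.
Qed.

Lemma tcat_ract i j (x : tpow i) (y : tpow j) r :
  tcat x (ract y r) = ract (tcat x y) r.
Proof.
elim: i x => [|i IH]; first by move=> x; rewrite /= lractA.
apply: tcons_ind; first exact: tcat_linearl.
  exact: lin_comp (@tcat_linearl _ _ _) (ract_linearl _).
by move=> m t; rewrite !tcat_tcons IH [RHS]ract_tcons.
Qed.

Lemma tcat_balance i j (x : tpow i) r (y : tpow j) :
  tcat (ract x r) y = tcat x (lact r y).
Proof.
elim: i x => [|i IH]; first by move=> x; rewrite /= -lactA.
apply: tcons_ind; last by move=> m t; rewrite ract_tcons !tcat_tcons IH.
  by apply: lin_comp (@tcat_linearl _ _ _); apply: ract_linearl.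
exact: tcat_linearl.
Qed.

Lemma tcatA i j k (x : tpow i) (y : tpow j) (z : tpow k) :
  tcat x (tcat y z) = tconv (i + (j + k)) (tcat (tcat x y) z).
Proof.
elim: i x => [|i IH]; first by move=> x; rewrite tconv_id /= tcat_lact.
apply: tcons_ind; first exact: tcat_linearl.
  apply: lin_comp (@tconv_linear _ _).
  exact: lin_comp (@tcat_linearl _ _ _) (@tcat_linearl _ _ _).
move=> m t; rewrite !tcat_tcons IH tcons_conv ?addnA //.
Qed.

Lemma tcat1t j (y : tpow j) : tcat (1 : tpow 0) y = y.
Proof. exact: lact1. Qed.

Lemma tcatt1 i (x : tpow i) : tcat x (1 : tpow 0) = tconv (i + 0) x.
Proof.
elim: i x => [|i IH]; first by move=> x; rewrite tconv_id; apply: mulr1.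
apply: tcons_ind; [exact: tcat_linearl | exact: tconv_linear |].
by move=> m t; rewrite tcat_tcons IH tcons_conv // addn0.
Qed.

Lemma tcat_convl i i' j (x : tpow i) (y : tpow j) :
  i = i' -> tcat (tconv i' x) y = tconv (i' + j) (tcat x y).
Proof. by move=> e; case: i' / e; rewrite !tconv_id. Qed.

Lemma tcat_convr i j j' (x : tpow i) (y : tpow j) :
  j = j' -> tcat x (tconv j' y) = tconv (i + j') (tcat x y).
Proof. by move=> e; case: j' / e; rewrite !tconv_id. Qed.

Lemma tcat_ind (X : lmodType K) i j (f g : tpow (i + j) -> X) :
  linear f -> linear g ->
  (forall (x : tpow i) (y : tpow j), f (tcat x y) = g (tcat x y)) -> f =1 g.
Proof.
elim: i f g => [|i IH] f g fL gL fg.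
  by move=> y; have := fg (1 : R) y; rewrite tcat1t.
apply: tcons_ind => // m; have [_ tr _] := tcons_balanced (i + j).
apply: (IH (fun t => f (tcons m t)) (fun t => g (tcons m t))).
- exact: lin_comp (tr m) fL.
- exact: lin_comp (tr m) gL.
by move=> x y; have := fg (tcons m x) y; rewrite tcat_tcons.
Qed.

Lemma tprod_ext i (m m' : 'I_i -> M) : m =1 m' -> tprod m = tprod m'.
Proof.
by elim: i m m' => //= i IH m m' E; rewrite E; congr tcons; apply: IH.
Qed.

Definition fcons i (m : M) (s : 'I_i -> M) (k : 'I_i.+1) : M :=
  if unlift ord0 k is Some k' then s k' else m.

Lemma fcons0 i m (s : 'I_i -> M) : fcons m s ord0 = m.
Proof. by rewrite /fcons unlift_none. Qed.

Lemma fcons_lift i m (s : 'I_i -> M) k : fcons m s (lift ord0 k) = s k.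
Proof. by rewrite /fcons liftK. Qed.

Lemma tprod_cons i m (s : 'I_i -> M) : tprod (fcons m s) = tcons m (tprod s).
Proof.
by rewrite /= fcons0; congr tcons; apply: tprod_ext => k; rewrite fcons_lift.
Qed.

Lemma tprod_ind (X : lmodType K) i (f g : tpow i.+1 -> X) :
  linear f -> linear g -> (forall m, f (tprod m) = g (tprod m)) -> f =1 g.
Proof.
elim: i f g => [|i IH] f g fL gL fg.
  apply: tcons_ind => // m r; have := fg (fun=> ract m r).
  by rewrite /= !ract1.
apply: tcons_ind => // m; have [_ tr _] := tcons_balanced i.+1.
apply: (IH (fun t => f (tcons m t)) (fun t => g (tcons m t))).
- exact: lin_comp (tr m) fL.
- exact: lin_comp (tr m) gL.
by move=> s; have := fg (fcons m s); rewrite tprod_cons.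
Qed.

Lemma tprodS i (m : 'I_i.+1 -> M) :
  tprod m = tcons (m ord0) (tprod (fun k => m (lift ord0 k))).
Proof. by []. Qed.

Lemma tprod_rcons n b (m : 'I_n.+1 -> M) (y : tpow b) :
  tcat (tprod (fun k => m (lift ord_max k))) (tcons (m ord_max) y) =
  tconv (n + b.+1) (tcat (tprod m) y).
Proof.
elim: n m => [|n IH] m.
  rewrite tcat1t tprodS tcat_tcons tcat1t tconv_id.
  by congr (tcons (m _) _); apply: val_inj.
rewrite [tprod m]tprodS tcat_tcons tprodS tcat_tcons.
have := IH (fun k => m (lift ord0 k)).
have -> : lift ord0 (@ord_max n) = ord_max by apply: val_inj.
have -> : lift ord_max (@ord0 n) = ord0 by apply: val_inj.
have E : @tprod n (fun k => m (lift ord_max (lift ord0 k))) =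
    @tprod n (fun k => m (lift ord0 (lift ord_max k))).
  apply: tprod_ext => k; congr m; apply: val_inj.
  by rewrite /= /bump /= !add1n ltnS addnS.
move=> H; transitivity (tcons (m ord0) (tconv (n + b.+1)
    (tcat (tprod (fun k => m (lift ord0 k))) y))).
  by rewrite -H -E.
by rewrite [LHS]tcons_conv // addnS.
Qed.

Definition rlinear n (psi : tpow n -> R) :=
  linear psi /\ forall x r, psi (ract x r) = psi x * r.

Lemma rlinear_tcons n (psi : tpow n.+1 -> R) m :
  rlinear psi -> rlinear (fun x => psi (tcons m x)).
Proof.
move=> [pl pr]; have [_ tr _] := tcons_balanced n.
split; first exact: lin_comp (tr m) pl.
by move=> x r; rewrite -ract_tcons pr.
Qed.

Lemma rlinear_lact n (psi : tpow n -> R) r :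
  rlinear psi -> rlinear (fun x => psi (lact r x)).
Proof.
move=> [pl pr]; split; first exact: lin_comp (lact_linearr r) pl.
by move=> x s; rewrite -lractA pr.
Qed.

Lemma contr_ext n k (psi psi' : tpow n -> R) :
  psi =1 psi' -> @contr n k psi =1 contr psi'.
Proof.
elim: n psi psi' => [|n IH] psi psi' E z /=; first by rewrite E.
by apply: tcons_lift_ext => m t; apply: IH => x; apply: E.
Qed.

Lemma contr_comb n k (p p' p'' : tpow n -> R) a z :
  (forall x, p x = a *: p' x + p'' x) ->
  @contr n k p z = a *: contr p' z + contr p'' z.
Proof.
elim: n p p' p'' z => [|n IH] p p' p'' z E /=.
  by rewrite E lact_linearl.
rewrite -tcons_lift_comb; apply: tcons_lift_ext => m t.
by apply: IH => x; apply: E.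
Qed.

Lemma contr_linear_param n k (psi : tpow n.+1 -> R) t :
  rlinear psi -> linear (fun m => @contr n k (fun x => psi (tcons m x)) t).
Proof.
move=> [pl _] a m m'; apply: contr_comb => x.
by have [tl _ _] := tcons_balanced n; rewrite tl pl.
Qed.

Lemma contr_linear n k (psi : tpow n -> R) :
  rlinear psi -> linear (@contr n k psi).
Proof.
case: n psi => [|n] psi pl /=; first exact: lact_linearr.
by apply: tcons_lift_linear => t; apply: contr_linear_param.
Qed.

Lemma contr_bal n k (psi : tpow n.+1 -> R) : rlinear psi ->
  (forall psi' r t, rlinear psi' ->
     @contr n k (fun x => psi' (lact r x)) t = contr psi' (lact r t)) ->
  balanced (fun m t => @contr n k (fun x => psi (tcons m x)) t).
Proof.
move=> pl H; split=> [t|m|m r t]; first exact: contr_linear_param.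
  by apply/contr_linear/rlinear_tcons.
rewrite -H; last exact: rlinear_tcons.
by apply: contr_ext => x; have [_ _ ->] := tcons_balanced n.
Qed.

Lemma contr_lact n k (psi : tpow n -> R) r t : rlinear psi ->
  @contr n k (fun x => psi (lact r x)) t = contr psi (lact r t).
Proof.
elim: n psi r t => [|n IH] psi r t pl.
  rewrite /= -lactA -(pl.2 1) /=; congr (lact (psi _) _).
  by rewrite -[LHS]/(r * 1) -[RHS]/(1 * r) mulr1 mul1r.
move: t; apply: tcons_ind.
  exact: (@contr_linear n.+1 k _ (rlinear_lact r pl)).
  by apply: lin_comp (contr_linear pl); apply: lact_linearr.
move=> m t; rewrite lact_tcons /=.
have B psi' : rlinear psi' -> balanced _ :=
  fun pl' => contr_bal pl' IH.
rewrite (tcons_liftE (B _ pl)) (tcons_liftE (B _ (rlinear_lact r pl))).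
by apply: contr_ext => x; rewrite -lact_tcons.
Qed.

Lemma contr_tcons n k (psi : tpow n.+1 -> R) m t : rlinear psi ->
  contr (k := k) psi (tcons m t) = contr (fun x => psi (tcons m x)) t.
Proof.
move=> pl; rewrite /=; apply: (tcons_liftE (contr_bal pl _)) => p r t' pl'.
exact: contr_lact.
Qed.

Lemma contr_tcat n k (psi : tpow n -> R) x (y : tpow k) : rlinear psi ->
  contr psi (tcat x y) = lact (psi x) y.
Proof.
elim: n psi x => [|n IH] psi x pl.
  by rewrite /= -lactA -(pl.2 1); congr (lact (psi _) _); apply: mul1r.
move: x; apply: tcons_ind.
- exact: lin_comp (@tcat_linearl _ _ _) (contr_linear pl).
- exact: lin_comp pl.1 (lact_linearl _).
by move=> m t; rewrite tcat_tcons contr_tcons // IH //; apply: rlinear_tcons.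
Qed.

Lemma tcat_contrl n k j (psi : tpow n -> R) (z : tpow (n + k)) (y : tpow j) :
  rlinear psi ->
  tcat (contr psi z) y = contr psi (tconv (n + (k + j)) (tcat z y)).
Proof.
move=> pl; move: z; apply: tcat_ind.
- exact: lin_comp (contr_linear pl) (@tcat_linearl _ _ _).
- apply: lin_comp (contr_linear pl).
  exact: lin_comp (@tcat_linearl _ _ _) (@tconv_linear _ _).
by move=> x z; rewrite contr_tcat // tcat_lact -tcatA contr_tcat.
Qed.

Record assoc_morph (n : nat) := AssocMorph {
  amap :> tpow n -> R;
  amap_morph : @bimod_morph (tpow n) reg_bimod amap;
  amap_assoc : forall m : 'I_n.+1 -> M,
    lact (amap (tprod (fun k => m (lift ord_max k)))) (m ord_max) =
    ract (m ord0) (amap (tprod (fun k => m (lift ord0 k))))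
}.

Section AssocMorph.

Variables (n : nat) (n_gt0 : (0 < n)%N) (phi : assoc_morph n).

Lemma amap_rlinear : rlinear phi.
Proof. by have [pl _ pr] := amap_morph phi; split. Qed.

Lemma contr_amap_lact k r (z : tpow (n + k)) :
  contr phi (lact r z) = lact r (contr phi z).
Proof.
move: z; apply: tcat_ind.
- by apply: lin_comp (contr_linear amap_rlinear); apply: lact_linearr.
- exact: lin_comp (contr_linear amap_rlinear) (lact_linearr _).
move=> x y; rewrite -tcat_lact !(contr_tcat _ _ amap_rlinear) -lactA.
by have [_ -> _] := amap_morph phi.
Qed.

Lemma tcons_contr b m (z : tpow (n + b)) :
  tcons m (contr phi z) = contr phi (tconv (n + b.+1) (tcons m z)).
Proof.
have pl := amap_rlinear; have [tl tr tb] := tcons_balanced b.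
have [_ tr' _] := tcons_balanced (n + b).
move: z; apply: tcat_ind.
- exact: lin_comp (contr_linear pl) (tr m).
- apply: lin_comp (contr_linear pl).
  exact: lin_comp (tr' m) (@tconv_linear _ _).
move=> x y; rewrite (contr_tcat _ _ pl) -tb.
case: n n_gt0 phi pl x {tl tr tb tr'} => // n' _ phi' pl x.
have [tl tr tb] := tcons_balanced b.
have [_ tr' _] := tcons_balanced (n'.+1 + b).
move: x; apply: tprod_ind.
- by apply: lin_comp (tl y); apply: lin_comp pl.1 (ract_linearr m).
- apply: lin_comp (contr_linear pl); apply: lin_comp (@tconv_linear _ _).
  exact: lin_comp (@tcat_linearl _ _ _) (tr' m).
move=> s; rewrite -tcat_tcons -tprod_cons.
have -> := esym (tprod_rcons (fcons m s) y); rewrite (contr_tcat _ _ pl).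
rewrite lact_tcons (amap_assoc phi') fcons0; congr (tcons (ract m (phi' _)) y).
by apply: tprod_ext => k; rewrite fcons_lift.
Qed.

Lemma tcat_contrr a b (x : tpow a) (z : tpow (n + b)) :
  tcat x (contr phi z) = contr phi (tconv (n + (a + b)) (tcat x z)).
Proof.
have pl := amap_rlinear; elim: a x => [|a IH].
  by move=> x; rewrite tconv_id /= contr_amap_lact.
apply: tcons_ind; first exact: tcat_linearl.
  apply: lin_comp (contr_linear pl).
  exact: lin_comp (@tcat_linearl _ _ _) (@tconv_linear _ _).
move=> m t; rewrite tcat_tcons IH [LHS]tcons_contr tcons_conv; last first.
  by rewrite addnCA.
rewrite tconv_trans; last by rewrite addnCA.
by rewrite [in RHS]tcat_tcons.
Qed.

End AssocMorph.

End TensorPowers.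

End Bimodules.

Section DirectSum.

Variables (K : fieldType) (N : nat) (T : 'I_N -> vectType K).

Definition dsum := {dffun forall i : 'I_N, T i}.

HB.instance Definition _ := Choice.on dsum.

Let dsum_add (x y : dsum) : dsum := finfun (fun i => x i + y i).
Let dsum_opp (x : dsum) : dsum := finfun (fun i => - x i).
Let dsum_zero : dsum := finfun (fun i => 0 : T i).
Let dsum_scale (a : K) (x : dsum) : dsum := finfun (fun i => a *: x i).

Fact dsum_addA : associative dsum_add.
Proof. by move=> x y z; apply/ffunP => i; rewrite !ffunE addrA. Qed.
Fact dsum_addC : commutative dsum_add.
Proof. by move=> x y; apply/ffunP => i; rewrite !ffunE addrC. Qed.
Fact dsum_add0 : left_id dsum_zero dsum_add.
Proof. by move=> x; apply/ffunP => i; rewrite !ffunE add0r. Qed.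
Fact dsum_addN : left_inverse dsum_zero dsum_opp dsum_add.
Proof. by move=> x; apply/ffunP => i; rewrite !ffunE addNr. Qed.

HB.instance Definition _ := GRing.isZmodule.Build dsum
  dsum_addA dsum_addC dsum_add0 dsum_addN.

Fact dsum_scaleA a b x : dsum_scale a (dsum_scale b x) = dsum_scale (a * b) x.
Proof. by apply/ffunP => i; rewrite !ffunE scalerA. Qed.
Fact dsum_scale1 : left_id 1 dsum_scale.
Proof. by move=> x; apply/ffunP => i; rewrite !ffunE scale1r. Qed.
Fact dsum_scaleDr : right_distributive dsum_scale +%R.
Proof. by move=> a x y; apply/ffunP => i; rewrite !ffunE scalerDr. Qed.
Fact dsum_scaleDl x : {morph dsum_scale^~ x : a b / a + b}.
Proof. by move=> a b; apply/ffunP => i; rewrite !ffunE scalerDl. Qed.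

HB.instance Definition _ := GRing.Zmodule_isLmodule.Build K dsum
  dsum_scaleA dsum_scale1 dsum_scaleDr dsum_scaleDl.

Lemma dsumD (x y : dsum) i : (x + y) i = x i + y i.
Proof. by rewrite ffunE. Qed.

Lemma dsumZ a (x : dsum) i : (a *: x) i = a *: x i.
Proof. by rewrite ffunE. Qed.

Lemma dsum0 i : (0 : dsum) i = 0.
Proof. by rewrite ffunE. Qed.

Import VectorInternalTheory.

Fact dsum_vect_iso : Vector.axiom (\sum_i dim (T i))%N dsum.
Proof.
exists (fun x : dsum => \mxrow_i v2r (x i)).
  move=> a x y; apply/matrixP => i j.
  by rewrite !mxE dsumD dsumZ linearP !mxE.
exists (fun r => finfun (fun i => r2v (submxrow r i)) : dsum) => [x|r].
  by apply/ffunP => i; rewrite ffunE mxrowK v2rK.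
by rewrite -[RHS]submxrowK; apply/eq_mxrow => i; rewrite ffunE r2vK.
Qed.

HB.instance Definition _ := Lmodule_hasFinDim.Build K dsum dsum_vect_iso.

End DirectSum.

Section FactorAlgebra.

Variables (K : fieldType) (R : falgType K) (M : bimodule R) (n : nat).
Variables (n_gt1 : (1 < n)%N) (phi : assoc_morph M n).

(* R (+) M (+) ... (+) M^(n-1); as n > 1, the type 'Z_n is {0, ..., n - 1}. *)
Definition factor_alg (_ : (1 < n)%N) (_ : assoc_morph M n) :=
  dsum (fun i : 'Z_n => bmod (tpow M i)).

Local Notation A := (factor_alg n_gt1 phi).

HB.instance Definition _ := Vector.on A.

(* The tensor t, of length i, placed in degree i < n. *)
Definition fhom (i : nat) (t : tpow M i) : A :=
  finfun (fun k : 'Z_n => tconv k t).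

(* The element of the algebra given by a tensor z of length l < 2 n: it is z
   itself, in degree l, if l < n, and otherwise the tensor of length l - n
   obtained by applying phi to the first n positions. *)
Definition fwrap (l : nat) (z : tpow M l) : A :=
  finfun (fun k : 'Z_n => tconv k z + contr phi (tconv (n + k) z)).

Definition fmul (x y : A) : A :=
  \sum_(i : 'Z_n) \sum_(j : 'Z_n) fwrap (tcat (x i) (y j)).

Definition fone : A := fhom (1 : tpow M 0).

Let Zn : (Zp_trunc n).+2 = n. Proof. exact: Zp_cast. Qed.
Let Zlt (i : 'Z_n) : (i < n)%N. Proof. by rewrite -[X in (_ < X)%N]Zn. Qed.
Let n_gt0 : (0 < n)%N. Proof. exact: ltnW. Qed.
Let phi_rl : rlinear phi. Proof. exact: amap_rlinear. Qed.

Lemma fhom_linear i : linear (@fhom i).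
Proof.
move=> a x y; apply/ffunP => k.
by rewrite [RHS]dsumD [in RHS]dsumZ !ffunE tconv_linear.
Qed.

Lemma fwrap_linear i : linear (@fwrap i).
Proof.
move=> a x y; apply/ffunP => k.
rewrite [RHS]dsumD [in RHS]dsumZ !ffunE !tconv_linear (contr_linear phi_rl).
by rewrite scalerDr -!addrA; congr (_ + _); rewrite addrCA.
Qed.

Lemma fwrap_conv l l' (z : tpow M l) : l = l' -> fwrap (tconv l' z) = fwrap z.
Proof. by move=> e; case: l' / e; rewrite tconv_id. Qed.

Lemma fhom_conv l l' (z : tpow M l) : l = l' -> fhom (tconv l' z) = fhom z.
Proof. by move=> e; case: l' / e; rewrite tconv_id. Qed.

Lemma fwrap_small l (z : tpow M l) : (l < n)%N -> fwrap z = fhom z.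
Proof.
move=> ln; apply/ffunP => k; rewrite !ffunE (@tconv_neq _ _ _ _ (n + k)).
  by rewrite (lin0 (contr_linear phi_rl)) addr0.
by rewrite neq_ltn ltn_addr.
Qed.

Lemma fwrap_big k (z : tpow M (n + k)) : (k < n)%N ->
  fwrap z = fhom (contr phi z).
Proof.
move=> kn; apply/ffunP => j; rewrite !ffunE tconv_neq ?add0r; last first.
  by rewrite neq_ltn orbC (leq_trans (Zlt j)) ?leq_addr.
have [E|E] := eqVneq k j.
  by case: (nat_of_ord j) / E; rewrite !tconv_id.
by rewrite !tconv_neq ?eqn_add2l // (lin0 (contr_linear phi_rl)).
Qed.

Lemma fhomE (x : A) : x = \sum_(i : 'Z_n) fhom (x i).
Proof.
apply/ffunP => k.
have -> : (\sum_(i : 'Z_n) fhom (x i)) k = \sum_(i : 'Z_n) (fhom (x i)) k.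
  apply: (big_morph (fun x : A => x k)) => [u v|]; first exact: dsumD.
  exact: dsum0.
rewrite (bigD1 k) //= ffunE tconv_id big1 ?addr0 // => i ik.
by rewrite ffunE tconv_neq.
Qed.

Lemma fmul_linearl y : linear (fmul^~ y).
Proof.
move=> a x x'; rewrite /fmul scaler_sumr -big_split; apply: eq_bigr => i _.
rewrite scaler_sumr -big_split; apply: eq_bigr => j _ /=.
by rewrite dsumD dsumZ tcat_linearl fwrap_linear.
Qed.

Lemma fmul_linearr x : linear (fmul x).
Proof.
move=> a y y'; rewrite /fmul scaler_sumr -big_split; apply: eq_bigr => i _.
rewrite scaler_sumr -big_split; apply: eq_bigr => j _ /=.
by rewrite dsumD dsumZ tcat_linearr fwrap_linear.
Qed.

Lemma fmul_fhom i j (x : tpow M i) (y : tpow M j) : (i < n)%N -> (j < n)%N ->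
  fmul (fhom x) (fhom y) = fwrap (tcat x y).
Proof.
move=> lin ljn; have iZ : (i < (Zp_trunc n).+2)%N by rewrite Zn.
have jZ : (j < (Zp_trunc n).+2)%N by rewrite Zn.
rewrite /fmul (bigD1 (Ordinal iZ)) //= (bigD1 (Ordinal jZ)) //=.
rewrite !ffunE !tconv_id big1 => [|k kj]; last first.
  rewrite ffunE tconv_neq; last by rewrite eq_sym; exact: kj.
  by rewrite (lin0 (@tcat_linearr _ _ _ _ _ _)) (lin0 (@fwrap_linear _)).
rewrite big1 ?addr0 // => k ki; rewrite big1 // => l _.
rewrite ffunE tconv_neq; last by rewrite eq_sym; exact: ki.
by rewrite (lin0 (@tcat_linearl _ _ _ _ _ _)) (lin0 (@fwrap_linear _)).
Qed.

(* The element given by a tensor of length l < 3 n. *)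
Let fwrap2 l (z : tpow M l) : A :=
  if (l < n)%N then fwrap z
  else fwrap (contr phi (tconv (n + (l - n)) z)).

Let fwrap2_conv l l' (z : tpow M l) :
  l = l' -> fwrap2 (tconv l' z) = fwrap2 z.
Proof. by move=> e; case: l' / e; rewrite tconv_id. Qed.

Let fwrap2E l (z : tpow M l) : (l < n + n)%N -> fwrap2 z = fwrap z.
Proof.
rewrite /fwrap2 => lnn; case: (ltnP l n) => // nl.
have E : l = (n + (l - n))%N by rewrite subnKC.
have kn : (l - n < n)%N by rewrite ltn_subLR.
by rewrite fwrap_small // -fwrap_big // fwrap_conv.
Qed.

Let fwrap2_contr k (z : tpow M (n + k)) : fwrap (contr phi z) = fwrap2 z.
Proof.
rewrite /fwrap2 ltnNge leq_addr /=.
have E : k = (n + k - n)%N by rewrite addKn.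
by move: (n + k - n)%N E => k' E; case: k' / E; rewrite tconv_id.
Qed.

Let fmul_wrapl l k (u : tpow M l) (z : tpow M k) : (l < n + n)%N -> (k < n)%N ->
  fmul (fwrap u) (fhom z) = fwrap2 (tcat u z).
Proof.
move=> lnn kn; have [ln|nl] := ltnP l n.
  by rewrite fwrap_small // fmul_fhom // fwrap2E // -addSn leq_add // ltnW.
have E : l = (n + (l - n))%N by rewrite subnKC.
have ln' : (l - n < n)%N by rewrite ltn_subLR.
rewrite -(fwrap_conv u E) fwrap_big // fmul_fhom // (tcat_contrl _ _ phi_rl).
rewrite fwrap2_contr fwrap2_conv ?addnA // tcat_convl // fwrap2_conv //.
by rewrite -E.
Qed.

Let fmul_wrapr l k (x : tpow M k) (u : tpow M l) : (l < n + n)%N -> (k < n)%N ->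
  fmul (fhom x) (fwrap u) = fwrap2 (tcat x u).
Proof.
move=> lnn kn; have [ln|nl] := ltnP l n.
  by rewrite fwrap_small // fmul_fhom // fwrap2E // -addSn leq_add // ltnW.
have E : l = (n + (l - n))%N by rewrite subnKC.
have ln' : (l - n < n)%N by rewrite ltn_subLR.
rewrite -(fwrap_conv u E) fwrap_big // fmul_fhom // (tcat_contrr n_gt0).
rewrite fwrap2_contr fwrap2_conv; last by rewrite addnCA.
by rewrite tcat_convr // fwrap2_conv // -E.
Qed.

Lemma fhom_ind (X : lmodType K) (f g : A -> X) : linear f -> linear g ->
  (forall (i : 'Z_n) (t : tpow M i), f (fhom t) = g (fhom t)) -> f =1 g.
Proof.
move=> fL gL fg x; rewrite (fhomE x) (lin_sum fL) (lin_sum gL).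
by apply: eq_bigr => i _; apply: fg.
Qed.

Lemma fmulA : associative fmul.
Proof.
move=> x y z; move: x.
apply: (@fhom_ind _ (fun x => fmul x (fmul y z)) (fun x => fmul (fmul x y) z)).
- exact: fmul_linearl.
- exact: lin_comp (fmul_linearl _) (fmul_linearl _).
move=> i x; move: y.
apply: (@fhom_ind _ (fun y => fmul _ (fmul y z)) (fun y => fmul (fmul _ y) z)).
- exact: lin_comp (fmul_linearl _) (fmul_linearr _).
- exact: lin_comp (fmul_linearr _) (fmul_linearl _).
move=> j y; move: z.
apply: (@fhom_ind _ (fun z => fmul _ (fmul _ z)) (fun z => fmul (fmul _ _) z)).
- exact: lin_comp (fmul_linearr _) (fmul_linearr _).
- exact: fmul_linearr.
move=> k z.
have lij : (i + j < n + n)%N by rewrite -addSn leq_add // ?Zlt // ltnW ?Zlt.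
have ljk : (j + k < n + n)%N by rewrite -addSn leq_add // ?Zlt // ltnW ?Zlt.
rewrite (fmul_fhom y z) ?Zlt // (fmul_fhom x y) ?Zlt //.
by rewrite fmul_wrapr ?Zlt // fmul_wrapl ?Zlt // tcatA fwrap2_conv // addnA.
Qed.

Lemma fmul1x : left_id fone fmul.
Proof.
move=> x; rewrite [in LHS](fhomE x) (lin_sum (fmul_linearr _)) [RHS]fhomE.
apply: eq_bigr => i _; rewrite fmul_fhom ?Zlt // tcat1t.
by rewrite fwrap_small ?Zlt.
Qed.

Lemma fmulx1 : right_id fone fmul.
Proof.
move=> x; rewrite [in LHS](fhomE x) (lin_sum (fmul_linearl _)) [RHS]fhomE.
apply: eq_bigr => i _; rewrite fmul_fhom ?Zlt // tcatt1.
by rewrite fwrap_conv ?addn0 // fwrap_small ?Zlt.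
Qed.

Lemma fone_neq0 : fone != 0.
Proof.
apply/eqP => /ffunP/(_ ord0); rewrite ffunE dsum0 tconv_id.
by apply/eqP/oner_neq0.
Qed.

Fact fmulDl : left_distributive fmul +%R.
Proof. by move=> x y z; rewrite (linD (fmul_linearl z)). Qed.

Fact fmulDr : right_distributive fmul +%R.
Proof. by move=> x y z; rewrite (linD (fmul_linearr x)). Qed.

HB.instance Definition _ := GRing.Zmodule_isNzRing.Build A
  fmulA fmul1x fmulx1 fmulDl fmulDr fone_neq0.

Fact fscalerAl (a : K) (x y : A) : a *: (x * y) = (a *: x) * y.
Proof. by rewrite -[RHS]/(fmul (a *: x) y) (linZ (fmul_linearl y)). Qed.

HB.instance Definition _ := GRing.Lmodule_isLalgebra.Build K A fscalerAl.

Fact fscalerAr (a : K) (x y : A) : a *: (x * y) = x * (a *: y).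
Proof. by rewrite -[RHS]/(fmul x (a *: y)) (linZ (fmul_linearr x)). Qed.

HB.instance Definition _ := GRing.Lalgebra_isAlgebra.Build K A fscalerAr.
HB.instance Definition _ := Algebra_isFalgebra.Build K A.

HB.instance Definition _ (i : nat) :=
  GRing.isSemilinear.Build K (tpow M i) A *:%R (@fhom i)
    (GRing.semilinear_linear (@fhom_linear i)).

Lemma fhomM i j (x : tpow M i) (y : tpow M j) : (i < n)%N -> (j < n)%N ->
  fhom x * fhom y = fwrap (tcat x y) :> A.
Proof. exact: fmul_fhom. Qed.

Definition fcomp (i : 'Z_n) : {vspace A} := limg (linfun (@fhom i)).

Lemma fcompP (i : 'Z_n) (x : A) :
  reflect (exists t : tpow M i, x = fhom t) (x \in fcomp i).
Proof.
apply: (iffP memv_imgP) => [[t _ ->]|[t ->]]; exists t; rewrite ?memvf //.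
  by rewrite lfunE.
by rewrite lfunE.
Qed.

Fact fcomp_full : (\sum_i fcomp i)%VS = fullv.
Proof.
apply/eqP; rewrite eqEsubv subvf /=; apply/subvP => x _.
rewrite (fhomE x); apply: memv_sumr => i _.
by apply/fcompP; exists (x i).
Qed.

Fact fcomp_direct : directv (\sum_i fcomp i).
Proof.
apply/directv_sum_independent => u uP u0 i _.
case/fcompP: (uP i isT) => t Et.
have : (\sum_i u i) i = 0 by rewrite u0 dsum0.
have -> : (\sum_i u i) i = \sum_k (u k i).
  apply: (big_morph (fun x : A => x i)) => [x y|]; first exact: dsumD.
  exact: dsum0.
rewrite (bigD1 i) //= big1 ?addr0 => [|k ki]; last first.
  by case/fcompP: (uP k isT) => t' ->; rewrite ffunE tconv_neq.
by rewrite Et ffunE tconv_id => ->; rewrite linear0.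
Qed.

Fact fcomp_mul (i j : 'Z_n) (x y : A) :
  x \in fcomp i -> y \in fcomp j -> x * y \in fcomp (i + j).
Proof.
case/fcompP=> s ->; case/fcompP=> t ->; rewrite fhomM ?Zlt //.
have E : (i + j)%R = ((i + j) %% n)%N :> nat by congr (_ %% _)%N; apply: Zn.
apply/fcompP; have [ln|nl] := ltnP (i + j) n.
  exists (tconv (i + j)%R (tcat s t)).
  by rewrite fwrap_small // fhom_conv // E modn_small.
have lnn : (i + j < n + n)%N by rewrite -addSn leq_add // ?Zlt // ltnW ?Zlt.
have kn : (i + j - n < n)%N by rewrite ltn_subLR.
have E' : (i + j)%R = (i + j - n)%N :> nat.
  by rewrite E -[in LHS](subnK nl) modnDr modn_small.
exists (tconv (i + j)%R (contr phi (tconv (n + (i + j - n)) (tcat s t)))).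
by rewrite fhom_conv // -fwrap_big // fwrap_conv // subnKC.
Qed.

End FactorAlgebra.

Section Frobenius.

Variables (K : fieldType) (B : falgType K).

Definition left_dual_morph (f : dual B -> B) : Prop :=
  linear f /\ forall b x, f (dual_lact b x) = b * f x.

Definition frobenius : Prop :=
  exists2 f : dual B -> B, left_dual_morph f & bijective f.

Definition symmetric_alg : Prop := bimod_iso (dual_bimod B) (reg_bimod B).

Definition frobenius_form (lam : dual B) : Prop :=
  forall f : dual B, exists b, f = dual_lact b lam.

Definition nakayama (lam : dual B) (nu : B -> B) : Prop :=
  forall r, dual_ract lam r = dual_lact (nu r) lam.

Variable G : finZmodType.

Record grading := Grading {
  gcomp :> G -> {vspace B};
  gcomp_full : (\sum_g gcomp g)%VS = fullv;
  gcomp_direct : directv (\sum_g gcomp g);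
  gcomp_mul : forall g h x y,
    x \in gcomp g -> y \in gcomp h -> x * y \in gcomp (g + h)
}.

Definition dual_gcomp (gr : grading) (g : G) (f : dual B) : Prop :=
  forall h, h != - g -> forall x, x \in gr h -> f x = 0.

(* An isomorphism from B^* to B(sigma), where B(sigma)_g = B_(g + sigma). *)
Definition graded_frobenius (gr : grading) (sigma : G) : Prop :=
  exists f : dual B -> B,
    [/\ left_dual_morph f, bijective f
      & forall g x, dual_gcomp gr g x <-> f x \in gr (g + sigma)].

End Frobenius.

Section NakayamaFacts.

Variables (K : fieldType) (B : falgType K) (lam : dual B).
Hypothesis lamF : frobenius_form lam.

Let lact_map := linfun (fun b => dual_lact b lam).

Let lact_mapE b : lact_map b = dual_lact b lam.
Proof.
pose f : {linear B -> dual B} := HB.pack (fun b => dual_lact b lam)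
  (GRing.isSemilinear.Build _ _ _ _ (fun b => dual_lact b lam)
    (GRing.semilinear_linear (@lact_linearl _ _ (dual_bimod B) lam))).
exact: (lfunE f b).
Qed.

Lemma frobenius_form_inj b b' : dual_lact b lam = dual_lact b' lam -> b = b'.
Proof.
suff /lker0P inj : lker lact_map == 0%VS by rewrite -!lact_mapE => /inj.
have lim : limg lact_map = fullv.
  apply/eqP; rewrite eqEsubv subvf /=; apply/subvP => f _.
  by have [c ->] := lamF f; rewrite -lact_mapE memv_img ?memvf.
have := limg_ker_dim lact_map fullv; rewrite capfv lim.
have dimE : dim (dual B) = dim B by apply: muln1.
rewrite -dimv_eq0 !dimvf dimE => /eqP.
by rewrite -[X in _ == X]add0n eqn_add2r.
Qed.

Lemma nakayama_uniq (nu nu' : B -> B) :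
  nakayama lam nu -> nakayama lam nu' -> nu =1 nu'.
Proof. by move=> nuP nuP' r; apply: frobenius_form_inj; rewrite -nuP. Qed.

Lemma nakayama_linear (nu : B -> B) : nakayama lam nu -> linear nu.
Proof.
move=> nuP a r s; apply: frobenius_form_inj; rewrite -nuP.
have -> : dual_ract lam (a *: r + s) = a *: dual_ract lam r + dual_ract lam s.
  exact: (@ract_linearr _ _ (dual_bimod B)).
by rewrite !nuP; apply/esym/(@lact_linearl _ _ (dual_bimod B)).
Qed.

Lemma nakayama_exists : exists nu : 'End(B), nakayama lam nu.
Proof.
pose g (r : B) := (lact_map^-1)%VF (dual_ract lam r).
have gP : nakayama lam g.
  move=> r; have [c E] := lamF (dual_ract lam r).
  by rewrite -lact_mapE limg_lfunVK // E -lact_mapE memv_img ?memvf.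
pose f : {linear B -> B} := HB.pack g
  (GRing.isSemilinear.Build _ _ _ _ g
    (GRing.semilinear_linear (nakayama_linear gP))).
by exists (linfun f) => r; rewrite lfunE -gP.
Qed.

Lemma nakayamaK (nu : 'End(B)) : nakayama lam nu ->
  cancel nu (nu^-1)%VF /\ cancel (nu^-1)%VF nu.
Proof.
move=> nuP; suff k0 : lker nu == 0%VS.
  by split; [apply: lker0_lfunK | apply: lker0_lfunVK].
rewrite -subv0; apply/subvP => x; rewrite memv_ker memv0 => /eqP nx0.
apply/eqP; rewrite (coord_vbasis (memvf x)) big1 // => i _.
pose f : dual B := linfun (coord (vbasis {:B}) i : B -> K^o).
have <- : f x = coord (vbasis {:B}) i x by rewrite lfunE.
have [c ->] := lamF f; rewrite dual_lactE -dual_ractE nuP dual_lactE nx0 mulr0.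
by rewrite linear0 scale0r.
Qed.

End NakayamaFacts.

Section Universal.

Variables (K : fieldType) (R : falgType K) (M : bimodule R) (n : nat).
Variables (n_gt1 : (1 < n)%N) (phi : assoc_morph M n).

Local Notation A := (factor_alg n_gt1 phi).

Definition factor_grading : grading A 'Z_n :=
  Grading (fcomp_full n_gt1 phi) (fcomp_direct n_gt1 phi)
    (@fcomp_mul _ _ _ _ n_gt1 phi).

Let Zn : (Zp_trunc n).+2 = n. Proof. exact: Zp_cast. Qed.
Let Zlt (i : 'Z_n) : (i < n)%N. Proof. by rewrite -[X in (_ < X)%N]Zn. Qed.
Let n_gt0 : (0 < n)%N. Proof. exact: ltnW. Qed.

Let inR (r : R) : A := fhom n_gt1 phi (r : tpow M 0).
Let inM (m : M) : A := fhom n_gt1 phi (m : tpow M 1).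

Lemma tcatm i (m : M) (t : tpow M i) : tcat (m : tpow M 1) t = tcons m t.
Proof.
by have := tcat_tcons m (1 : tpow M 0) t; rewrite tcat1t /= ract1.
Qed.

Lemma fhom_tcons i (m : M) (t : tpow M i) : (i.+1 < n)%N ->
  fhom n_gt1 phi (tcons m t) = inM m * fhom n_gt1 phi t.
Proof.
by move=> lin; rewrite /inM fhomM // 1?ltnW // tcatm fwrap_small.
Qed.

Lemma inR_monoid_morphism : monoid_morphism inR.
Proof. by split=> // r s; rewrite /inR fhomM // fwrap_small. Qed.

Lemma inM_lact r m : inM (lact r m) = inR r * inM m.
Proof. by rewrite /inR /inM fhomM // fwrap_small. Qed.

Lemma inM_ract m r : inM (ract m r) = inM m * inR r.
Proof. by rewrite /inR /inM fhomM // tcatm fwrap_small. Qed.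

Lemma fhom_tprod i (m : 'I_i -> M) : (i < n)%N ->
  fhom n_gt1 phi (tprod m) = \prod_k inM (m k).
Proof.
elim: i m => [|i IH] m lin; first by rewrite big_ord0.
by rewrite tprodS fhom_tcons // IH 1?ltnW // big_ord_recl.
Qed.

Lemma inM_phi (m : 'I_n -> M) : \prod_k inM (m k) = inR (phi (tprod m)).
Proof.
have E : n.-1.+1 = n by rewrite prednK.
have key l (e : l.+1 = n) (s : 'I_l.+1 -> M) :
    \prod_k inM (s k) = fwrap n_gt1 phi (tprod s).
  have ln : (l < n)%N by rewrite -e.
  by rewrite big_ord_recl -fhom_tprod // /inM fhomM // tcatm.
have key' l (e : l = n) (s : 'I_l -> M) :
    \prod_k inM (s k) = fwrap n_gt1 phi (tprod s).
  by case: l e s => [|l'] e s; [exfalso; move: n_gt0; rewrite -e | apply: key].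
rewrite key' // -(fwrap_conv n_gt1 phi _ (esym (addn0 n))) fwrap_big //.
congr (fhom _ _ _); have := tcatt1 (tprod m) => <-.
by rewrite (contr_tcat _ _ (amap_rlinear phi)) -[LHS]/(_ * 1) mulr1.
Qed.

Section Extension.

Variables (B : algType K) (f : {lrmorphism R -> B}) (g : {linear M -> B}).
Hypothesis g_lact : forall r m, g (lact r m) = f r * g m.
Hypothesis g_ract : forall m r, g (ract m r) = g m * f r.
Hypothesis g_phi :
  forall m : 'I_n -> M, \prod_k g (m k) = f (phi (tprod m)).

Fixpoint tmap (i : nat) : tpow M i -> B :=
  match i with
  | 0 => f
  | i'.+1 => tcons_lift (fun m t => g m * tmap t)
  end.

Let tmap_linear i : linear (@tmap i).
Proof.
case: i => [|i]; first by move=> a x y; apply: (linearP f).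
by apply: tcons_lift_linear => t a x y; rewrite linearP mulrDl scalerAl.
Qed.

Let tmap_lact i r (t : tpow M i) : tmap (lact r t) = f r * tmap t.
Proof.
elim: i r t => [|i IH] r t; first exact: rmorphM.
move: t; apply: tcons_ind.
- by apply: lin_comp (@tmap_linear _); apply: lact_linearr.
- by move=> a x y; rewrite tmap_linear mulrDr scalerAr.
have B0 : balanced (fun m (t : tpow M i) => g m * tmap t).
  split=> [t|m|m s t].
  - by move=> a x y; rewrite linearP mulrDl scalerAl.
  - by move=> a x y; rewrite tmap_linear mulrDr scalerAr.
  - by rewrite g_ract -mulrA -IH.
by move=> m t; rewrite lact_tcons /= !(tcons_liftE B0) g_lact mulrA.
Qed.

Let tmap_tcons i m (t : tpow M i) : tmap (tcons m t) = g m * tmap t.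
Proof.
apply: (@tcons_liftE _ _ M _ i (fun m (t : tpow M i) => g m * tmap t)).
split=> [s|k|k r s].
- by move=> a x y; rewrite linearP mulrDl scalerAl.
- by move=> a x y; rewrite tmap_linear mulrDr scalerAr.
- by rewrite g_ract -mulrA -tmap_lact.
Qed.

Let tmap_conv i j (t : tpow M i) : i = j -> tmap (tconv j t) = tmap t.
Proof. by move=> e; case: j / e; rewrite tconv_id. Qed.

Let tmap_tcat i j (x : tpow M i) (y : tpow M j) :
  tmap (tcat x y) = tmap x * tmap y.
Proof.
elim: i x => [|i IH]; first by move=> x; apply: tmap_lact.
apply: tcons_ind.
- exact: lin_comp (@tcat_linearl _ _ _ _ _ _) (@tmap_linear _).
- by move=> a u v; rewrite tmap_linear mulrDl scalerAl.
by move=> m t; rewrite tcat_tcons [LHS]tmap_tcons IH tmap_tcons mulrA.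
Qed.

Let tmap_tprod i (m : 'I_i -> M) : tmap (tprod m) = \prod_k g (m k).
Proof.
elim: i m => [|i IH] m; first by rewrite big_ord0 /= rmorph1.
by rewrite tprodS tmap_tcons IH big_ord_recl.
Qed.

Let tmap_phi (x : tpow M n) : f (phi x) = tmap x.
Proof.
have E : n.-1.+1 = n by rewrite prednK.
have key l (e : l = n) (psi : tpow M l -> R) : linear psi ->
    (forall m, f (psi (tprod m)) = \prod_k g (m k)) ->
    forall x, f (psi x) = tmap x.
  case: l e psi => [|l'] e psi psiL H; first by exfalso; move: n_gt0; rewrite -e.
  apply: tprod_ind; last by move=> m; rewrite H tmap_tprod.
    by move=> a u v; rewrite psiL linearP.
  exact: tmap_linear.
by apply: key => //; exact: (amap_rlinear phi).1.
Qed.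

Let tmap_contr k (z : tpow M (n + k)) : tmap (contr phi z) = tmap z.
Proof.
have rl := amap_rlinear phi.
move: z; apply: tcat_ind; last first.
  by move=> x y; rewrite (contr_tcat _ _ rl) tmap_lact tmap_phi tmap_tcat.
  exact: tmap_linear.
exact: lin_comp (contr_linear rl) (@tmap_linear _).
Qed.

Let ext (x : A) : B := \sum_(i : 'Z_n) tmap (x i).

Let ext_linear : linear ext.
Proof.
move=> a x y; rewrite /ext scaler_sumr -big_split; apply: eq_bigr => i _ /=.
by rewrite dsumD dsumZ tmap_linear.
Qed.

Let ext_fhom i (t : tpow M i) : (i < n)%N -> ext (fhom n_gt1 phi t) = tmap t.
Proof.
move=> lin; have iZ : (i < (Zp_trunc n).+2)%N by rewrite Zn.
rewrite /ext (bigD1 (Ordinal iZ)) //= ffunE tconv_id big1 ?addr0 // => k ki.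
rewrite ffunE tconv_neq; last by rewrite eq_sym; exact: ki.
exact: lin0 (@tmap_linear _).
Qed.

Let ext_fwrap l (z : tpow M l) : (l < n + n)%N ->
  ext (fwrap n_gt1 phi z) = tmap z.
Proof.
move=> lnn; have [ln|nl] := ltnP l n; first by rewrite fwrap_small // ext_fhom.
have E : l = (n + (l - n))%N by rewrite subnKC.
have kn : (l - n < n)%N by rewrite ltn_subLR.
by rewrite -(fwrap_conv _ _ _ E) fwrap_big // ext_fhom // tmap_contr tmap_conv.
Qed.

Let ext_monoid : monoid_morphism ext.
Proof.
split; first by rewrite [LHS](ext_fhom (1 : tpow M 0)) //= rmorph1.
move=> x y; move: x; apply: fhom_ind.
- by move=> a u v; rewrite mulrDl -scalerAl ext_linear.
- by move=> a u v; rewrite ext_linear mulrDl scalerAl.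
move=> i x; move: y; apply: fhom_ind.
- by move=> a u v; rewrite mulrDr -scalerAr ext_linear.
- by move=> a u v; rewrite ext_linear mulrDr scalerAr.
move=> j y; rewrite fhomM ?Zlt // ext_fwrap; last first.
  by rewrite -addSn leq_add // ?Zlt // ltnW ?Zlt.
by rewrite !ext_fhom ?Zlt // tmap_tcat.
Qed.

(* The universal property of the quotient of the tensor algebra T_R(M) by the
   elements m_1 (x) ... (x) m_n - phi (m_1 (x) ... (x) m_n). *)
Lemma factor_alg_universal :
  exists h : {lrmorphism A -> B},
    [/\ forall r, h (inR r) = f r, forall m, h (inM m) = g m
      & forall h' : {lrmorphism A -> B}, (forall r, h' (inR r) = f r) ->
          (forall m, h' (inM m) = g m) -> h' =1 h].
Proof.
pose h : {lrmorphism A -> B} := HB.pack ext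
  (GRing.isSemilinear.Build _ _ _ _ ext (GRing.semilinear_linear ext_linear))
  (GRing.isMonoidMorphism.Build _ _ ext ext_monoid).
exists h; split=> [r|m|h' h'R h'M].
- exact: ext_fhom.
- by rewrite [LHS]ext_fhom //= rmorph1 mulr1.
have H i (t : tpow M i) : (i < n)%N -> h' (fhom n_gt1 phi t) = tmap t.
  elim: i t => [|i IH] t lin; first exact: h'R.
  move: t; apply: tcons_ind.
  - by move=> a u v; rewrite !linearP.
  - exact: tmap_linear.
  by move=> m t; rewrite fhom_tcons // rmorphM /= h'M IH 1?ltnW // [RHS]tmap_tcons.
apply: fhom_ind.
- by move=> a u v; rewrite linearP.
- exact: ext_linear.
by move=> i t; rewrite H ?Zlt // [RHS]ext_fhom ?Zlt.
Qed.

End Extension.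

End Universal.

Section FormOnFactorAlgebra.

Variables (K : fieldType) (R : falgType K) (n : nat) (n_gt1 : (1 < n)%N).
Variable phi : assoc_morph (dual_bimod R) n.

Local Notation A := (factor_alg n_gt1 phi).

(* (r_0 . lam) (x) ... (x) (r_(i-1) . lam), in degree i < n *)
Definition lam_tensor (lam : dual R) (i : nat) (r : 'I_i -> R) : A :=
  fhom n_gt1 phi
    (tprod (M := dual_bimod R) (fun k => dual_lact (r k) lam)).

Definition induced_form (lam : dual R) (nu : R -> R) (Lam : dual A) : Prop :=
  (forall r : 'I_(n - 1) -> R,
      Lam (lam_tensor lam r) = lam (\prod_(k < n - 1) iter k nu (r k)))
  /\ (forall i : 'Z_n, i != (n - 1)%:R ->
      forall x, x \in factor_grading n_gt1 phi i -> Lam x = 0).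

End FormOnFactorAlgebra.

(* Main.v *)
Require Import Defs.
From HB Require Import structures.
From mathcomp Require Import all_boot all_order all_algebra all_field.

(** Write M = R^* and A = A(R, M, phi).  A product of two homogeneous elements
    of degrees i, j < n has a component in degree n - 1 only if i + j = n - 1,
    because i + j = 2 n - 1 is impossible; such a product is a plain
    concatenation of tensors.  Hence a linear form on A that lives in degree
    n - 1 never sees phi, and for such a form Frobenius, symmetry and Nakayama
    questions reduce to the pairings M^i x M^j -> K with i + j = n - 1 given by
    concatenation ([top_form], [top_form_frobenius], [top_form_sym]).

    Part (i).  Let k = n - 2, let theta : M^k -> R be an isomorphism of
    bimodules, and e = theta^-1(1), which satisfies r e = e r.  Then
    m (x) t |-> m theta(t) identifies M^(k+1) with M, with inverse
    m |-> m (x) e, and evaluation at 1 gives the form L on M^(k+1).  It is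
    nondegenerate: if L vanishes on m (x) z (x) x for all m and z, then
    z (x) x = 0 for all z, so e (x) x = 0, and contracting by theta gives
    x = 0.  The point is that L is invariant under cyclic rotation.  The map
    sending m to the image of e (x) m in M is a bimodule endomorphism of R^*,
    that is, multiplication by a central d, and so e (x) m = d m (x) e.  This
    element d measures the failure of symmetry, and it satisfies two equations.
    Moving e past the k factors of another copy of e gives d^k = 1
    ([twist_expk]).  Rotating one factor of a tensor in M^(k+1) changes L by d,
    so rotating all of them, which does nothing, gives d^(k+1) = 1
    ([twist_expSk]).  Therefore d = 1 and L gives a symmetric form on A
    ([factor_alg_symmetric]).

    Part (ii).  Let lambda be a Frobenius form on R with Nakayama automorphism
    nu.  As lambda r = nu(r) lambda, the bimodule M is R lambda with right
    action twisted by nu, and each M^i is free of rank one on the left, with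
    coordinate g (r_1 lambda (x) ... (x) r_i lambda) =
    r_1 nu(r_2) ... nu^(i-1)(r_i).  It satisfies g (x (x) y) = g(x) nu^i(g(y))
    for x of length i ([tensor_coord_cat]).  The form Lambda of the statement is
    lambda o g in degree n - 1.  Its nondegeneracy and its Nakayama
    automorphism follow from this formula together with
    lambda (r s) = lambda (s nu(r)) and lambda o nu = lambda
    ([twisted_form_frobenius], [twisted_form_nakayama]). *)

Set Implicit Arguments.
Unset Strict Implicit.
Unset Printing Implicit Defensive.

Import GRing.Theory.
Local Open Scope ring_scope.

(** * The dual of a finite-dimensional algebra *)

Section Dual.

Variables (K : fieldType) (B : falgType K).

Definition lin_form (f : B -> K) (fL : linear (f : B -> K^o)) : dual B :=
  linfun (HB.pack_for {linear B -> K^o} (f : B -> K^o)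
    (GRing.isSemilinear.Build _ _ _ _ (f : B -> K^o)
       (GRing.semilinear_linear fL))).

Lemma lin_formE f (fL : linear (f : B -> K^o)) b : lin_form fL b = f b.
Proof. by rewrite /lin_form lfunE. Qed.

Lemma dual_separates (b : B) : (forall m : dual B, m b = 0) -> b = 0.
Proof.
move=> mb; rewrite (coord_vbasis (memvf b)) big1 // => i _.
have := mb (linfun (coord (vbasis {:B}) i : B -> K^o)).
by rewrite lfunE /= => ->; rewrite scale0r.
Qed.

Lemma dual_functional (h : dual B -> K) : linear (h : dual B -> K^o) ->
  exists b : B, forall m : dual B, h m = m b.
Proof.
move=> hL; pose X := vbasis {:B}.
pose c (i : 'I_(\dim {:B})) : dual B := linfun (coord X i : B -> K^o).
have mE (m : dual B) : m = \sum_(i < \dim {:B}) m X`_i *: c i.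
  apply/lfunP => x; rewrite sum_lfunE {1}(coord_vbasis (memvf x)) linear_sum.
  apply: eq_bigr => i _.
  by rewrite linearZ scale_lfunE lfunE /= [RHS]mulrC.
exists (\sum_(i < \dim {:B}) h (c i) *: X`_i) => m.
rewrite {1}(mE m) (lin_sum hL) linear_sum; apply: eq_bigr => i _.
by rewrite (linZ hL) linearZ [LHS]mulrC.
Qed.

(** A bimodule endomorphism of B^* is the transpose of a bimodule endomorphism
    of B, hence multiplication by a central element. *)
Lemma dual_bimod_endo (h : dual B -> dual B) :
  @bimod_morph _ B (dual_bimod B) (dual_bimod B) h ->
  exists2 d : B, forall b, d * b = b * d & forall m, h m = dual_lact d m.
Proof.
case=> hL hl hr.
have {}hl b m : h (dual_lact b m) = dual_lact b (h m) by apply: hl.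
have {}hr m b : h (dual_ract m b) = dual_ract (h m) b by apply: hr.
have [|d hd] := @dual_functional (fun m => h m 1).
  by move=> a m m'; rewrite hL add_lfunE scale_lfunE.
have hE m b : h m b = m (d * b).
  have := hd (dual_lact b m); rewrite dual_lactE => <-.
  by rewrite hl dual_lactE mul1r.
have hE' m b : h m b = m (b * d).
  have := hd (dual_ract m b); rewrite dual_ractE => <-.
  by rewrite hr dual_ractE mulr1.
exists d => [b|m]; last by apply/lfunP => b; rewrite hE' dual_lactE.
apply/eqP; rewrite -subr_eq0; apply/eqP/dual_separates => m.
by rewrite linearB /= -hE hE' subrr.
Qed.

End Dual.

(** * Frobenius forms *)

Section Forms.

Variables (K : fieldType) (B : falgType K).
Implicit Types (lam : dual B) (b x : B).

Lemma frobenius_form_of_nondeg lam :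
  (forall b, (forall x, lam (x * b) = 0) -> b = 0) -> frobenius_form lam.
Proof.
move=> nd; pose F b := dual_lact b lam.
have FL : linear F by apply: (@lact_linearl _ _ (dual_bimod B)).
pose G := linfun (HB.pack_for {linear B -> dual B} F
  (GRing.isSemilinear.Build _ _ _ _ F (GRing.semilinear_linear FL))).
have GE b : G b = dual_lact b lam by rewrite /G lfunE.
have /eqP kG : lker G == 0%VS.
  rewrite -subv0; apply/subvP => b; rewrite memv_ker memv0 GE => /eqP Fb.
  by apply/eqP/nd => x; rewrite -dual_lactE Fb zero_lfunE.
have limG : limg G = fullv.
  apply/eqP; rewrite eqEdim subvf /= limg_dim_eq ?kG ?capv0 //.
  by rewrite !dimvf; apply/eq_leq/muln1.
move=> f; have /memv_imgP[b _ ->] : f \in limg G by rewrite limG memvf.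
by exists b; rewrite GE.
Qed.

Lemma frobenius_form_nondeg lam b : frobenius_form lam ->
  (forall x, lam (x * b) = 0) -> b = 0.
Proof.
move=> lamF lb; apply: (frobenius_form_inj lamF); apply/lfunP => x.
by rewrite !dual_lactE lb mulr0 linear0.
Qed.

Lemma frobenius_form_iso lam : frobenius_form lam ->
  exists2 f : dual B -> B, left_dual_morph f &
    cancel f (fun b => dual_lact b lam) /\ cancel (fun b => dual_lact b lam) f.
Proof.
move=> lamF.
have ex (g : dual B) : exists b, g == dual_lact b lam.
  by have [b ->] := lamF g; exists b.
pose f g := xchoose (ex g).
have fK : cancel f (fun b => dual_lact b lam).
  by move=> g; apply/esym/eqP/(xchooseP (ex g)).
have fI b : f (dual_lact b lam) = b.
  by apply: (frobenius_form_inj lamF); apply: fK.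
exists f => //; split=> [a g g'|b g]; rewrite -[LHS]fI -[RHS]fI; congr f.
  have -> : dual_lact (a *: f g + f g') lam =
      a *: dual_lact (f g) lam + dual_lact (f g') lam.
    exact: (@lact_linearl _ _ (dual_bimod B)).
  by rewrite !fK.
have -> : dual_lact (b * f g) lam = dual_lact b (dual_lact (f g) lam).
  exact: (@lactA _ _ (dual_bimod B)).
by rewrite !fK.
Qed.

Lemma frobenius_of_form lam : frobenius_form lam -> frobenius B.
Proof.
case/frobenius_form_iso=> f fl [fK Kf]; exists f => //.
by exists (fun b => dual_lact b lam).
Qed.

Lemma frobenius_has_form : frobenius B -> exists lam, frobenius_form lam.
Proof.
case=> f [_ fl] [g fK gK]; exists (g 1) => m; exists (f m).
by apply: (can_inj fK); rewrite fl gK mulr1.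
Qed.

(** For a form with lam (x y) = lam (y x), the isomorphism of left modules
    b |-> b lam is also right linear, because b lam = lam b. *)
Lemma symmetric_of_form lam : frobenius_form lam ->
  (forall x y, lam (x * y) = lam (y * x)) -> symmetric_alg B.
Proof.
move=> lamF sym; have [f [fL fl] [fK Kf]] := frobenius_form_iso lamF.
exists f; last by exists (fun b => dual_lact b lam).
split=> // g r; rewrite -[RHS]Kf; congr f; apply/lfunP => x.
rewrite dual_ractE -{1}[g]fK !dual_lactE -[ract _ _]/(f g * r).
by rewrite sym mulrA sym.
Qed.

(** The graded isomorphism is b |-> b lam: the value of b lam on a homogeneous
    element of degree h involves only the component of b of degree sigma - h. *)
Lemma graded_frobenius_of_form (G : finZmodType) (gr : grading B G) sigma lam :
  frobenius_form lam ->
  (forall g, g != sigma -> forall x, x \in gr g -> lam x = 0) ->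
  graded_frobenius gr sigma.
Proof.
move=> lamF lam0; have [f fl [fK Kf]] := frobenius_form_iso lamF.
exists f; split=> //; first by exists (fun b => dual_lact b lam).
move=> g m; rewrite -[m in dual_gcomp _ _ m]fK; set b := f m; split; last first.
  move=> bg h hg x xh; rewrite dual_lactE; apply: (lam0 (h + (g + sigma))).
    by rewrite addrA -subr_eq0 addrK addr_eq0.
  exact: gcomp_mul.
move=> bm.
have /memv_sumP[c cP bE] : b \in (\sum_g gr g)%VS by rewrite gcomp_full memvf.
suff c0 h : h != g + sigma -> c h = 0.
  rewrite bE (bigD1 (g + sigma)) //= big1 => [|h]; last exact: c0.
  by rewrite addr0 cP.
move=> hg; apply: (frobenius_form_nondeg lamF) => x.
have /memv_sumP[y yP ->] : x \in (\sum_g gr g)%VS by rewrite gcomp_full memvf.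
rewrite mulr_suml linear_sum big1 // => j _.
have [jh|jh] := eqVneq (j + h) sigma; last first.
  by apply: (lam0 (j + h)) => //; apply: gcomp_mul; rewrite ?yP ?cP.
have jg : j != - g.
  by apply: contraNneq hg => jE; rewrite -jh jE addrA subrr add0r.
have := bm j jg (y j) (yP j isT); rewrite dual_lactE bE mulr_sumr linear_sum.
rewrite (bigD1 h) //= big1 ?addr0 // => i ih.
apply: (lam0 (j + i)); last by apply: gcomp_mul; rewrite ?yP ?cP.
by rewrite -jh (inj_eq (addrI _)).
Qed.

End Forms.

(** * Forms concentrated in the top degree of A(R, M, phi) *)

Section TopDegree.

Variables (K : fieldType) (R : falgType K) (M : bimodule R) (n : nat).
Variables (n_gt1 : (1 < n)%N) (phi : assoc_morph M n).

Local Notation A := (factor_alg n_gt1 phi).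
Local Notation fh := (fhom n_gt1 phi).

Let Zn : (Zp_trunc n).+2 = n. Proof. exact: Zp_cast. Qed.
Let Zlt (i : 'Z_n) : (i < n)%N. Proof. by rewrite -[X in (_ < X)%N]Zn. Qed.

Definition component l (x : A) : tpow M l := \sum_(i : 'Z_n) tconv l (x i).

Lemma component_linear l : linear (@component l).
Proof.
move=> a x y; rewrite /component scaler_sumr -big_split; apply: eq_bigr => i _.
by rewrite dsumD dsumZ tconv_linear.
Qed.

Lemma component_fhom l i (t : tpow M i) : (i < n)%N ->
  component l (fh t) = tconv l t.
Proof.
move=> lin; have iZ : (i < (Zp_trunc n).+2)%N by rewrite Zn.
rewrite /component (bigD1 (Ordinal iZ)) //= ffunE tconv_id.
rewrite big1 ?addr0 // => k ki.
rewrite ffunE (@tconv_neq _ _ _ i k); last by rewrite eq_sym; exact: ki.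
exact: lin0 (@tconv_linear _ _ _ _ _).
Qed.

(** When i + j >= n, the product has degree i + j - n <= n - 2: contractions by
    phi never reach the top degree. *)
Lemma component_mul l i j (x : tpow M i) (y : tpow M j) :
  n = l.+1 -> (i < n)%N -> (j < n)%N ->
  component l (fh x * fh y) = tconv l (tcat x y).
Proof.
move=> nE lin ljn; rewrite fhomM //.
have [ln|nl] := ltnP (i + j) n; first by rewrite fwrap_small // component_fhom.
have E : (i + j = n + (i + j - n))%N by rewrite subnKC.
have kl : (i + j - n < l)%N.
  rewrite ltn_subLR // nE addSn ltnS; apply: leq_add.
    by rewrite -ltnS -nE.
  by rewrite -ltnS -nE.
have kn : (i + j - n < n)%N by rewrite (ltn_trans kl) // nE.
rewrite -(fwrap_conv n_gt1 phi _ E) fwrap_big // component_fhom //.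
rewrite !tconv_neq //; first by rewrite neq_ltn orbC (leq_trans _ nl) // nE.
by rewrite neq_ltn kl.
Qed.

Section Form.

Variables (l : nat) (nE : n = l.+1) (L : tpow M l -> K).
Hypothesis L_lin : linear (L : tpow M l -> K^o).

(** The degree l is n - 1: in any lower degree, the values of such a form on
    products can involve phi. *)
Definition top_form : dual A :=
  lin_form (lin_comp (@component_linear l) L_lin).

Lemma top_formE x : top_form x = L (component l x).
Proof. exact: lin_formE. Qed.

Lemma top_form_mul i j (x : tpow M i) (y : tpow M j) :
  (i < n)%N -> (j < n)%N -> top_form (fh x * fh y) = L (tconv l (tcat x y)).
Proof. by move=> li lj; rewrite top_formE component_mul. Qed.

Lemma top_form_fhom i (x : tpow M i) : (i < n)%N ->
  top_form (fh x) = L (tconv l x).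
Proof. by move=> li; rewrite top_formE component_fhom. Qed.

Lemma top_form_degree (i : 'Z_n) x : i != (n - 1)%:R ->
  x \in factor_grading n_gt1 phi i -> top_form x = 0.
Proof.
move=> iN /fcompP[t ->]; rewrite top_form_fhom ?Zlt // tconv_neq.
  exact: (lin0 L_lin).
apply: contra iN => /eqP iE; apply/eqP/val_inj.
rewrite [LHS]iE [RHS](val_Zp_nat n_gt1) modn_small nE subn1 //=.
Qed.

Lemma top_form_frobenius :
  (forall i j (x : tpow M i), (i + j = l)%N ->
     (forall y : tpow M j, L (tconv l (tcat y x)) = 0) -> x = 0) ->
  frobenius_form top_form.
Proof.
move=> nd; apply: frobenius_form_of_nondeg => b b0.
rewrite (fhomE b) big1 // => i _.
have il : (i <= l)%N by rewrite -ltnS -nE Zlt.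
rewrite (nd i (l - i)%N (b i)); first exact: linear0.
  by rewrite subnKC.
move=> y.
have jn : (l - i < n)%N by rewrite (leq_ltn_trans (leq_subr _ _)) // nE.
have := b0 (fh y); rewrite {1}(fhomE b) mulr_sumr linear_sum.
rewrite (bigD1 i) //= top_form_mul ?Zlt // big1 ?addr0 // => k ki.
rewrite top_form_mul ?Zlt // tconv_neq; first exact: (lin0 L_lin).
by rewrite -[X in _ != X](subnK il) eqn_add2l.
Qed.

Lemma top_form_sym :
  (forall i j (x : tpow M i) (y : tpow M j), (i + j = l)%N ->
     L (tconv l (tcat x y)) = L (tconv l (tcat y x))) ->
  forall x y, top_form (x * y) = top_form (y * x).
Proof.
move=> sym x y; rewrite (fhomE x) (fhomE y) mulr_suml mulr_sumr !linear_sum.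
apply: eq_bigr => i _; rewrite mulr_sumr mulr_suml !linear_sum.
apply: eq_bigr => j _; rewrite /= !top_form_mul ?Zlt //.
have [ij|ij] := eqVneq (i + j)%N l; first exact: sym.
by rewrite !tconv_neq // addnC.
Qed.

End Form.

End TopDegree.

(** * The case where the tensor power of length n - 2 is the regular bimodule *)

Section TensorActions.

Variables (K : fieldType) (R : falgType K) (M : bimodule R).

Lemma tconv_lact i j r (x : tpow M i) :
  tconv j (lact r x) = lact r (tconv j x).
Proof.
have [<-|ij] := eqVneq i j; first by rewrite !tconv_id.
by rewrite !tconv_neq // (lin0 (lact_linearr r)).
Qed.

Lemma tconv_ract i j r (x : tpow M i) :
  tconv j (ract x r) = ract (tconv j x) r.
Proof.
have [<-|ij] := eqVneq i j; first by rewrite !tconv_id.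
by rewrite !tconv_neq // (lin0 (ract_linearl r)).
Qed.

Lemma tconv_inj i j (x y : tpow M i) : i = j -> tconv j x = tconv j y -> x = y.
Proof. by move=> ij; case: j / ij; rewrite !tconv_id. Qed.

(** A central scalar that commutes with M can be carried through all the
    positions of a tensor. *)
Lemma tensor_central d : (forall r, d * r = r * d) ->
  (forall m : M, lact d m = ract m d) ->
  forall i (x : tpow M i), lact d x = ract x d.
Proof.
move=> dR dM; elim=> [|i IH]; first exact: dR.
apply: tcons_ind; [exact: lact_linearr | exact: ract_linearl |].
move=> m t; rewrite lact_tcons ract_tcons dM -IH.
by have [_ _ ->] := tcons_balanced M i.
Qed.

End TensorActions.

Section ScalarsInFactorAlgebra.

Variables (K : fieldType) (R : falgType K) (M : bimodule R) (n : nat).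
Variables (n_gt1 : (1 < n)%N) (phi : assoc_morph M n).

Local Notation fh := (fhom n_gt1 phi).

Lemma fhom_cat i j (x : tpow M i) (y : tpow M j) : (i + j < n)%N ->
  fh (tcat x y) = fh x * fh y.
Proof.
move=> ijn; rewrite fhomM ?fwrap_small //.
  exact: leq_ltn_trans (leq_addr j i) ijn.
exact: leq_ltn_trans (leq_addl i j) ijn.
Qed.

Lemma fhom_lact i r (x : tpow M i) : (i < n)%N ->
  fh (lact r x) = fh (r : tpow M 0) * fh x.
Proof. exact: (@fhom_cat 0 i). Qed.

Lemma fhom_ract i r (x : tpow M i) : (i < n)%N ->
  fh (ract x r) = fh x * fh (r : tpow M 0).
Proof.
move=> lin; rewrite -fhom_cat ?addn0 //.
rewrite -[r in RHS]mul1r -[1 * r]/(ract (1 : tpow M 0) r) tcat_ract tcatt1.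
by rewrite -tconv_ract fhom_conv ?addn0.
Qed.

End ScalarsInFactorAlgebra.

Section SymmetricCase.

Variables (K : fieldType) (R : falgType K) (k : nat).

Local Notation M := (dual_bimod R).

Variables (theta : tpow M k -> R) (thetaV : R -> tpow M k).
Hypothesis theta_morph : @bimod_morph _ _ (tpow M k) (reg_bimod R) theta.
Hypotheses (thetaK : cancel theta thetaV) (thetaVK : cancel thetaV theta).

Let theta_lin : linear theta. Proof. by case: theta_morph. Qed.
Let theta_lact r x : theta (lact r x) = r * theta x.
Proof. by case: theta_morph. Qed.
Let theta_ract x r : theta (ract x r) = theta x * r.
Proof. by case: theta_morph. Qed.
Let theta_inj : injective theta. Proof. exact: can_inj thetaK. Qed.

Local Notation e := (thetaV 1).

Let lact_e y : lact (theta y) e = y.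
Proof. by apply: theta_inj; rewrite theta_lact thetaVK mulr1. Qed.

Let e_central r : lact r e = ract e r.
Proof.
by apply: theta_inj; rewrite theta_lact theta_ract thetaVK mulr1 mul1r.
Qed.

(** The isomorphism M^(k+1) = M (x) M^k -> M (x) R = M induced by theta; its
    inverse is m |-> m (x) e. *)
Definition dual_of_tensor : tpow M k.+1 -> dual R :=
  tcons_lift (fun (m : M) t => ract m (theta t)).

Local Notation f := dual_of_tensor.

Let f_bal : balanced (fun (m : M) t => ract m (theta t)).
Proof.
split=> [t|m|m r t]; first exact: ract_linearl.
  exact: lin_comp theta_lin (ract_linearr m).
by rewrite theta_lact ractA.
Qed.

Lemma dual_of_tcons (m : M) t : f (tcons m t) = ract m (theta t).
Proof. exact: (tcons_liftE f_bal). Qed.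

Lemma dual_of_tensor_linear : linear f.
Proof. by apply: tcons_lift_linear => t; apply: ract_linearl. Qed.

Lemma dual_of_tensor_lact r x : f (lact r x) = lact (r : R) (f x : M).
Proof.
move: x; apply: tcons_ind.
- by apply: lin_comp dual_of_tensor_linear; apply: lact_linearr.
- exact: lin_comp dual_of_tensor_linear (@lact_linearr _ _ M r).
by move=> m t; rewrite lact_tcons !dual_of_tcons -lractA.
Qed.

Lemma dual_of_tensor_ract x r : f (ract x r) = ract (f x : M) (r : R).
Proof.
move: x; apply: tcons_ind.
- by apply: lin_comp dual_of_tensor_linear; apply: ract_linearl.
- exact: lin_comp dual_of_tensor_linear (@ract_linearl _ _ M r).
by move=> m t; rewrite ract_tcons !dual_of_tcons theta_ract ractA.
Qed.

Lemma dual_of_tensorV x : tcons (f x : M) e = x.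
Proof.
have [tl tr tb] := tcons_balanced M k.
move: x; apply: tcons_ind => // [|m t].
  exact: lin_comp dual_of_tensor_linear (tl e).
by rewrite dual_of_tcons tb lact_e.
Qed.

Lemma dual_of_tensorK (m : M) : f (tcons m e) = m.
Proof. by rewrite dual_of_tcons thetaVK ract1. Qed.

Definition tensor_form (x : tpow M k.+1) : K := f x 1.

Lemma tensor_form_linear : linear (tensor_form : tpow M k.+1 -> K^o).
Proof.
move=> a x y; rewrite /tensor_form dual_of_tensor_linear.
by rewrite add_lfunE scale_lfunE.
Qed.

Lemma tensor_form_lact r x : tensor_form (lact r x) = f x r.
Proof. by rewrite /tensor_form dual_of_tensor_lact dual_lactE mul1r. Qed.

Lemma tensor_form_ract r x : tensor_form (ract x r) = f x r.
Proof. by rewrite /tensor_form dual_of_tensor_ract dual_ractE mulr1. Qed.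

(** For j > 0, testing against y = m (x) z for all m kills theta (z (x) x), hence
    z (x) x for every z of length j - 1.  As the products w (x) z span M^k, this
    gives e (x) x = 0, and contracting by theta leaves theta(e) x = x. *)
Lemma tensor_form_nondeg i j (x : tpow M i) : (i + j = k.+1)%N ->
  (forall y : tpow M j, tensor_form (tconv k.+1 (tcat y x)) = 0) -> x = 0.
Proof.
case: j => [|j] ij x0.
  move: ij; rewrite addn0 => ij; case: _ / (esym ij) x x0 => x x0.
  rewrite -[x]dual_of_tensorV.
  suff -> : f x = 0 by case: (tcons_balanced M k) => tl _ _; apply: lin0 (tl e).
  apply/lfunP => r; rewrite zero_lfunE -tensor_form_lact.
  by have := x0 r; rewrite tconv_id.
have jik : (j + i = k)%N by apply: succn_inj; rewrite -ij addnS addnC.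
have zx (z : tpow M j) : tcat z x = 0.
  apply: (tconv_inj jik); apply: theta_inj.
  rewrite (lin0 (@tconv_linear _ _ _ _ _)) (lin0 theta_lin).
  apply: dual_separates => m.
  have := x0 (tcons (m : M) z).
  rewrite tcat_tcons -tcons_conv // /tensor_form dual_of_tcons.
  by rewrite dual_ractE mulr1.
have ux (u : tpow M (i + j)) : tcat u x = 0.
  move: u; apply: tcat_ind.
  - exact: tcat_linearl.
  - by move=> a u v; rewrite scaler0 addr0.
  move=> w z; apply: (@tconv_inj _ _ _ _ (i + (j + i))); first by rewrite addnA.
  rewrite -tcatA zx (lin0 (@tcat_linearr _ _ _ _ _ _)).
  by rewrite (lin0 (@tconv_linear _ _ _ _ _)).
have ijk : (i + j = k)%N by rewrite addnC.
have ex : tcat e x = 0 by case: _ / ijk (e) => u; apply: ux.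
have := contr_tcat e x (conj theta_lin theta_ract).
rewrite ex thetaVK lact1 => <-.
exact: lin0 (contr_linear (conj theta_lin theta_ract)).
Qed.

(** The element d compares the two identifications of M^(k+1) with M, by theta on
    the last k positions and by theta on the first k positions: they differ by a
    bimodule endomorphism of R^*. *)
Lemma twist_exists : exists d : R,
  (forall i (x : tpow M i), lact d x = ract x d) /\
  (forall m : M, tconv k.+1 (tcat e (m : tpow M 1)) = lact d (tcons m e)).
Proof.
pose h (m : dual R) := f (tconv k.+1 (tcat e (m : tpow M 1))).
have [|d dR hd] := @dual_bimod_endo _ R h.
  split=> [a m m'|r m|m r]; rewrite /h.
  - by rewrite (@tcat_linearr _ _ M k 1) tconv_linear dual_of_tensor_linear.
  - rewrite -[X in tcat _ X]/(lact r (m : tpow M 1)) -tcat_balance -e_central.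
    by rewrite tcat_lact tconv_lact dual_of_tensor_lact.
  - rewrite -[X in tcat _ X]/(ract (m : tpow M 1) r) tcat_ract.
    rewrite -dual_of_tensor_ract; congr f.
    move: (tcat _ _) => z; have E : (k + 1 = k.+1)%N by rewrite addn1.
    by case: _ / E; rewrite !tconv_id.
exists d; split=> [|m].
  apply: tensor_central => // m; apply/lfunP => r.
  by rewrite dual_lactE dual_ractE dR.
by rewrite -[LHS]dual_of_tensorV lact_tcons -[f _]/(h m) hd.
Qed.

Section Twist.

Variable d : R.
Hypothesis d_tensor : forall i (x : tpow M i), lact d x = ract x d.
Hypothesis d_twist :
  forall m : M, tconv k.+1 (tcat e (m : tpow M 1)) = lact d (tcons m e).

Let dX_tensor i (x : tpow M i) j : lact (d ^+ j) x = ract x (d ^+ j).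
Proof.
elim: j => [|j IH]; first by rewrite lact1 ract1.
by rewrite exprS lactA IH d_tensor -ractA -exprSr exprS.
Qed.

(** Each of the j factors of x that e passes contributes one d, and the
    occurrences of d can be collected on the left. *)
Lemma twist_commute j (x : tpow M j) :
  tconv (j + k) (tcat e x) = lact (d ^+ j) (tcat x e).
Proof.
elim: j x => [|j IH] x.
  rewrite lact1 -[x in LHS]mul1r -[1 * x]/(ract (1 : tpow M 0) x).
  rewrite tcat_ract tcatt1 tconv_ract tconv_trans ?addn0 // tconv_id.
  by rewrite -e_central.
move: x; apply: tcons_ind.
- exact: lin_comp (@tcat_linearr _ _ _ _ _ _) (@tconv_linear _ _ _ _ _).
- exact: lin_comp (@tcat_linearl _ _ _ _ _ _) (lact_linearr _).
move=> m t; rewrite -{1}tcatm.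
rewrite -[tcat e _]/(@tcat _ _ M k (1 + j) e (tcat (m : tpow M 1) t)).
rewrite tcatA tconv_trans -?addnA //.
rewrite -(@tconv_trans _ _ _ _ (k.+1 + j)) ?addn1 //.
rewrite -tcat_convl ?addn1 // d_twist tcat_lact tconv_lact tcat_tcons.
rewrite -[tconv _ _]tcons_conv; last exact: addnC.
rewrite IH.
have [_ _ tb] := tcons_balanced M (j + k).
by rewrite -tb -(@dX_tensor 1 m) -lact_tcons -lactA -exprS tcat_tcons.
Qed.

(** With x = e, the relation e (x) e = d^k e (x) e contracts under theta to
    e = d^k e. *)
Lemma twist_expk : d ^+ k = 1.
Proof.
have E := twist_commute e; rewrite tconv_id in E.
have := congr1 (contr theta) E.
have tr : rlinear theta := conj theta_lin theta_ract.
rewrite -tcat_lact !(contr_tcat _ _ tr) theta_lact thetaVK mulr1 lact1.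
move=> /(congr1 theta); rewrite theta_lact thetaVK mulr1 => {1}<-.
by [].
Qed.

Variables (n_gt1 : (1 < k.+2)%N) (phi : assoc_morph M k.+2).

Local Notation A := (factor_alg n_gt1 phi).
Local Notation fh := (fhom n_gt1 phi).
Local Notation Lam := (top_form n_gt1 phi tensor_form_linear).

(** Writing z = r e, the tensor z (x) m equals r d m (x) e, while d m (x) z equals
    d m r (x) e; the corresponding elements of R^* take the same value at 1. *)
Lemma top_form_rotate1 (m : M) (z : tpow M k) :
  Lam (fh z * fh (m : tpow M 1)) =
  Lam (fh (d : tpow M 0) * (fh (m : tpow M 1) * fh z)).
Proof.
rewrite -fhom_tcons // -(@fhom_lact _ _ _ _ n_gt1 phi k.+1 d) //.
rewrite top_form_mul //.
rewrite top_form_fhom // tconv_id tensor_form_lact dual_of_tcons dual_ractE.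
rewrite -{1}(lact_e z) tcat_lact tconv_lact d_twist -lactA tensor_form_lact.
by rewrite dual_of_tensorK.
Qed.

(** The factors of x move to the front one at a time, each at the cost of one d.
    This is carried out inside A, where all products involved have length at
    most n - 1, so that associativity replaces the identification of tensor powers. *)
Lemma top_form_rotate i j (x : tpow M i) (y : tpow M j) : (i + j = k.+1)%N ->
  Lam (fh y * fh x) = Lam (fh (d ^+ i : tpow M 0) * (fh x * fh y)).
Proof.
elim: i j x y => [|i IH] j x y.
  rewrite add0n => jk; case: _ / (esym jk) y => y.
  rewrite mul1r -fhom_ract // -fhom_lact // !top_form_fhom // !tconv_id.
  by rewrite tensor_form_lact tensor_form_ract.
move=> ijk.
have ijk' : (i + j = k)%N by apply: succn_inj; rewrite -ijk.
have ik : (i < k.+1)%N by rewrite -ijk leq_addr.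
have jk : (j < k.+1)%N by rewrite -ijk addSn ltnS leq_addl.
move: x; apply: tcons_ind.
- by move=> a u v; rewrite !linearP mulrDr -scalerAr linearP.
- by move=> a u v; rewrite !linearP mulrDl -scalerAl mulrDr -scalerAr linearP.
move=> m t; rewrite fhom_tcons // mulrA.
have ymE : fh (tcat y (m : tpow M 1)) = fh y * fh (m : tpow M 1).
  by apply: fhom_cat; rewrite addn1.
have zE : fh (d ^+ i : tpow M 0) * (fh t * fh y) =
    fh (tconv k (lact (d ^+ i) (tcat t y))).
  by rewrite fhom_conv // fhom_lact ?fhom_cat // ijk' // ltnW.
rewrite -ymE IH; last by rewrite addnA addn1 -addSn.
rewrite ymE (mulrA (fh t)) mulrA zE top_form_rotate1 -zE.
have -> : fh (d ^+ i.+1 : tpow M 0) =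
    fh (d : tpow M 0) * fh (d ^+ i : tpow M 0).
  by rewrite exprS -fhom_lact.
have dm : fh (m : tpow M 1) * fh (d ^+ i : tpow M 0) =
    fh (d ^+ i : tpow M 0) * fh (m : tpow M 1).
  by rewrite -fhom_lact // -fhom_ract // dX_tensor.
by rewrite [in LHS](mulrA (fh (m : tpow M 1))) dm !mulrA.
Qed.

(** A full turn (j = 0) leaves the tensor unchanged but multiplies the form by
    d^(k+1); evaluating on m (x) e for all m separates the points of R. *)
Lemma twist_expSk : d ^+ k.+1 = 1.
Proof.
apply/eqP; rewrite -subr_eq0; apply/eqP/dual_separates => m.
have := @top_form_rotate k.+1 0 (tcons (m : M) e) (1 : R) (addn0 _).
rewrite -[fh (1 : tpow M 0)]/(1 : A) mul1r mulr1 -fhom_lact //.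
rewrite !top_form_fhom // !tconv_id.
rewrite tensor_form_lact /tensor_form dual_of_tensorK linearB /= => ->.
by rewrite subrr.
Qed.

End Twist.

Lemma factor_alg_symmetric (n_gt1 : (1 < k.+2)%N) (phi : assoc_morph M k.+2) :
  symmetric_alg (factor_alg n_gt1 phi).
Proof.
have [d [d_tensor d_twist]] := twist_exists.
have d1 : d = 1.
  have := twist_expSk d_tensor d_twist n_gt1 phi.
  by rewrite exprS twist_expk // mulr1.
have LamF := @top_form_frobenius _ _ _ _ n_gt1 phi k.+1 erefl _
  tensor_form_linear tensor_form_nondeg.
apply: (symmetric_of_form LamF); apply: top_form_sym => // i j x y ij.
have ik : (i < k.+2)%N by rewrite ltnS -ij leq_addr.
have jk : (j < k.+2)%N by rewrite ltnS -ij leq_addl.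
have := top_form_rotate d_tensor d_twist n_gt1 phi x y ij.
by rewrite d1 expr1n mul1r !top_form_mul // => ->.
Qed.

End SymmetricCase.

(** * The case where R is Frobenius *)

Section NakayamaMorphism.

Variables (K : fieldType) (R : falgType K) (lam : dual R) (nu : 'End(R)).
Hypotheses (lamF : frobenius_form lam) (nuP : nakayama lam nu).

Lemma nakayama_swap r s : lam (r * s) = lam (s * nu r).
Proof. by rewrite -dual_ractE nuP dual_lactE. Qed.

(** This invariance is what makes the exponents of nu add up in the Nakayama
    automorphism of A. *)
Lemma nakayama_form r : lam (nu r) = lam r.
Proof. by rewrite -[nu r]mul1r -nakayama_swap mulr1. Qed.

Lemma nakayama1 : nu 1 = 1.
Proof.
apply: (frobenius_form_inj lamF); rewrite -nuP; apply/lfunP => x.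
by rewrite dual_ractE dual_lactE mulr1 mul1r.
Qed.

Lemma nakayamaM r s : nu (r * s) = nu r * nu s.
Proof.
apply: (frobenius_form_inj lamF); rewrite -nuP; apply/lfunP => x.
rewrite dual_ractE dual_lactE -mulrA [LHS]nakayama_swap -mulrA.
by rewrite [LHS]nakayama_swap mulrA.
Qed.

Lemma iter_nakayama_form i r : lam (iter i nu r) = lam r.
Proof. by elim: i => //= i IH; rewrite nakayama_form. Qed.

Lemma iter_nakayama1 i : iter i nu 1 = 1.
Proof. by elim: i => //= i ->; rewrite nakayama1. Qed.

Lemma iter_nakayamaM i r s : iter i nu (r * s) = iter i nu r * iter i nu s.
Proof. by elim: i => //= i ->; rewrite nakayamaM. Qed.

Lemma iter_nakayamaK i : cancel (iter i (nu^-1)%VF) (iter i nu).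
Proof.
have [_ nuVK] := nakayamaK lamF nuP.
by elim: i => // i IH r; rewrite iterSr iterS nuVK IH.
Qed.

Lemma iter_nakayama_inj i : injective (iter i nu).
Proof.
have [nuK _] := nakayamaK lamF nuP.
by elim: i => // i IH r s; rewrite !iterS => /(can_inj nuK)/IH.
Qed.

End NakayamaMorphism.

Section FrobeniusCase.

Variables (K : fieldType) (R : falgType K) (lam : dual R) (nu : 'End(R)).
Hypotheses (lamF : frobenius_form lam) (nuP : nakayama lam nu).

Local Notation M := (dual_bimod R).

Variable c : dual R -> R.
Hypotheses (c_morph : left_dual_morph c)
  (cK : cancel c (fun r => dual_lact r lam))
  (Kc : cancel (fun r => dual_lact r lam) c).

Let c_lin : linear c. Proof. by case: c_morph. Qed.
Let c_lact r m : c (dual_lact r m) = r * c m. Proof. by case: c_morph. Qed.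

Let c_ract m r : c (dual_ract m r) = c m * nu r.
Proof.
rewrite -[RHS]Kc; congr c; apply/lfunP => s.
by rewrite dual_ractE -{1}[m]cK !dual_lactE -mulrA (nakayama_swap nuP) mulrA.
Qed.

(** In closed form, r_1 lam (x) ... (x) r_i lam |-> r_1 nu(r_2) ... nu^(i-1)(r_i):
    the scalars are moved to the left through lam r = nu(r) lam.  The recursion
    makes the multiplicativity of [tensor_coord_cat] an easy induction. *)
Fixpoint tensor_coord i : tpow M i -> R :=
  match i with
  | 0 => id
  | i'.+1 => tcons_lift (fun m (t : tpow M i') => c m * nu (tensor_coord t))
  end.

Local Notation g := tensor_coord.

Lemma tensor_coord_linear i : linear (@g i).
Proof.
case: i => [|i]; first by [].
by apply: tcons_lift_linear => t a m m'; rewrite c_lin mulrDl scalerAl.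
Qed.

Let g_bal i : (forall r (t : tpow M i), g (lact r t) = r * g t) ->
  balanced (fun (m : M) (t : tpow M i) => c m * nu (g t)).
Proof.
move=> glact; split=> [t|m|m r t].
- by move=> a m m'; rewrite c_lin mulrDl scalerAl.
- by move=> a t t'; rewrite tensor_coord_linear linearP mulrDr scalerAr.
- rewrite -[ract m r]/(dual_ract m r) c_ract glact.
  by rewrite (nakayamaM lamF nuP) mulrA.
Qed.

Lemma tensor_coord_lact i r (t : tpow M i) : g (lact r t) = r * g t.
Proof.
elim: i r t => [|i IH] r t //; move: t; apply: tcons_ind.
- by apply: lin_comp (@tensor_coord_linear _); apply: lact_linearr.
- by move=> a x y; rewrite tensor_coord_linear mulrDr scalerAr.
move=> m t; rewrite lact_tcons /= !(tcons_liftE (g_bal IH)).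
by rewrite [c _]c_lact mulrA.
Qed.

Lemma tensor_coord_tcons i (m : M) (t : tpow M i) :
  g (tcons m t) = c m * nu (g t).
Proof. exact: (tcons_liftE (g_bal (@tensor_coord_lact i))). Qed.

Lemma tensor_coord_conv i j (x : tpow M i) : i = j -> g (tconv j x) = g x.
Proof. by move=> ij; case: j / ij; rewrite tconv_id. Qed.

Lemma tensor_coord_cat i j (x : tpow M i) (y : tpow M j) :
  g (tcat x y) = g x * iter i nu (g y).
Proof.
elim: i x => [|i IH]; first by move=> x; apply: tensor_coord_lact.
apply: tcons_ind.
- exact: lin_comp (@tcat_linearl _ _ _ _ _ _) (@tensor_coord_linear _).
- by move=> a u v; rewrite tensor_coord_linear mulrDl scalerAl.
move=> m t; rewrite tcat_tcons [LHS]tensor_coord_tcons IH tensor_coord_tcons.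
by rewrite (nakayamaM lamF nuP) mulrA.
Qed.

Lemma tensor_coord_tprod i (r : 'I_i -> R) :
  g (tprod (M := M) (fun k => dual_lact (r k) lam)) =
  \prod_(k < i) iter k nu (r k).
Proof.
elim: i r => [|i IH] r; first by rewrite big_ord0.
rewrite tprodS tensor_coord_tcons IH big_ord_recl Kc.
by rewrite (big_morph nu (nakayamaM lamF nuP) (nakayama1 lamF nuP)).
Qed.

(** Since m (x) r y = m r (x) y, all the scalars of a tensor can travel to the
    first position; so lam (x) ... (x) lam freely generates M^i. *)
Lemma tensor_coordK i (x : tpow M i) :
  lact (g x) (tprod (M := M) (fun=> lam)) = x.
Proof.
elim: i x => [|i IH] x; first exact: mulr1.
rewrite tprodS lact_tcons; have [tl tr tb] := tcons_balanced M i.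
move: x; apply: (@tcons_ind _ _ M _ i
  (fun x => tcons (lact (g x) (lam : M)) (tprod (M := M) (fun=> lam))) id).
- move=> a x y; rewrite tensor_coord_linear.
  by rewrite (@lact_linearl _ _ M) tl.
- by [].
move=> m t; rewrite tensor_coord_tcons.
transitivity (@tcons _ _ M i (ract m (g t)) (tprod (M := M) (fun=> lam)));
  last by rewrite tb IH.
congr tcons; rewrite -[m in RHS]cK; apply/lfunP => s.
by rewrite /= dual_ractE !dual_lactE -mulrA [RHS](nakayama_swap nuP) mulrA.
Qed.

Lemma tensor_coord_inj i : injective (@g i).
Proof. by move=> x y gxy; rewrite -[x]tensor_coordK gxy tensor_coordK. Qed.

Lemma tensor_coord_surj i r : exists x : tpow M i, g x = r.
Proof.
exists (lact r (tprod (M := M) (fun=> lam))); rewrite tensor_coord_lact.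
have -> : tprod (fun=> lam : M) = tprod (fun k : 'I_i => dual_lact 1 lam : M).
  by apply: tprod_ext => k; rewrite -[RHS]/(lact 1 (lam : M)) lact1.
rewrite tensor_coord_tprod big1 ?mulr1 // => k _.
exact: (iter_nakayama1 lamF nuP).
Qed.

(** In length 0 the only product of this kind is 1, which spans K and not R;
    hence the condition l > 0. *)
Lemma lam_tprod_ind (X : lmodType K) l (f h : tpow M l -> X) : (0 < l)%N ->
  linear f -> linear h ->
  (forall r : 'I_l -> R, f (tprod (M := M) (fun k => dual_lact (r k) lam)) =
                         h (tprod (M := M) (fun k => dual_lact (r k) lam))) ->
  f =1 h.
Proof.
case: l f h => // l f h _ fL hL fh; apply: tprod_ind => // m.
have -> : tprod m = tprod (M := M) (fun k => dual_lact (c (m k)) lam).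
  by apply: tprod_ext => k; rewrite cK.
exact: fh.
Qed.

Definition coord_form l (x : tpow M l) : K := lam (g x).

Lemma coord_form_linear l : linear (@coord_form l : tpow M l -> K^o).
Proof. by move=> a x y; rewrite /coord_form tensor_coord_linear linearP. Qed.

Lemma coord_form_nondeg l i j (x : tpow M i) : (i + j = l)%N ->
  (forall y : tpow M j, coord_form (tconv l (tcat y x)) = 0) -> x = 0.
Proof.
move=> ijl x0; apply: tensor_coord_inj; rewrite (lin0 (@tensor_coord_linear _)).
apply: (iter_nakayama_inj lamF nuP (i := j)).
have -> : iter j nu 0 = 0 by elim: (j) => //= j' ->; rewrite linear0.
apply: (frobenius_form_nondeg lamF) => r.
have [y <-] := tensor_coord_surj j r.
have := x0 y; rewrite /coord_form tensor_coord_conv ?tensor_coord_cat //.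
by rewrite addnC.
Qed.

Variables (n : nat) (n_gt1 : (1 < n)%N) (phi : assoc_morph M n).

Local Notation A := (factor_alg n_gt1 phi).
Local Notation fh := (fhom n_gt1 phi).

Let nE : n = (n - 1).+1. Proof. by rewrite subn1 prednK // ltnW. Qed.
Let Zlt (i : 'Z_n) : (i < n)%N.
Proof. by rewrite -[X in (_ < X)%N](Zp_cast n_gt1). Qed.

Definition twisted_form : dual A :=
  top_form n_gt1 phi (@coord_form_linear (n - 1)).

Local Notation Lam := twisted_form.

Lemma twisted_form_frobenius : frobenius_form Lam.
Proof.
by apply: (top_form_frobenius nE) => i j x; apply: coord_form_nondeg.
Qed.

Lemma twisted_form_induced : induced_form lam nu Lam.
Proof.
split=> [r|i iN x xi]; last exact: top_form_degree iN xi.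
rewrite /lam_tensor top_form_fhom ?tconv_id ?[X in (_ < X)%N]nE //.
by rewrite /coord_form tensor_coord_tprod.
Qed.

Lemma induced_form_unique (Lam' : dual A) :
  induced_form lam nu Lam' -> Lam' = Lam.
Proof.
case=> Lr L0; have [Fr F0] := twisted_form_induced.
apply/lfunP; apply: fhom_ind => [a x y|a x y|i t]; try by rewrite linearP.
have [iN|iN] := eqVneq i (n - 1)%:R; last first.
  rewrite (L0 i iN) ?(F0 i iN) //; apply/fcompP; by exists t.
have iE : i = (n - 1)%N :> nat.
  by rewrite iN val_Zp_nat // modn_small // {2}nE.
case: (nat_of_ord i) / (esym iE) t.
apply: lam_tprod_ind => [||| r]; first by rewrite subn_gt0.
- by move=> a x y; rewrite !linearP.
- by move=> a x y; rewrite !linearP.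
by rewrite -[fh _]/(lam_tensor n_gt1 phi lam r) Lr Fr.
Qed.

(** With i + j = n - 1, Lambda (x y) = lam (g(x) nu^i(g(y))) =
    lam (nu^i(g(y)) nu(g(x))), and nu(g(x)) = nu^(n-1)(g(x')) =
    nu^i(nu^j(g(x'))).  Removing nu^i by invariance of lam leaves lam (g(y) nu^j(g(x'))) =
    Lambda (y x'). *)
Lemma twisted_form_nakayama i (x x' : tpow M i) (N : A -> A) : (i < n)%N ->
  nakayama Lam N -> g x = iter (n - 2) nu (g x') -> N (fh x) = fh x'.
Proof.
move=> lin NP gx.
apply: (frobenius_form_inj twisted_form_frobenius); rewrite -NP.
apply/lfunP; apply: fhom_ind => [a y z|a y z|j y]; try by rewrite linearP.
rewrite dual_ractE dual_lactE !top_form_mul ?Zlt //.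
have [ij|ij] := eqVneq (i + j)%N (n - 1)%N; last by rewrite !tconv_neq // addnC.
have ji : (j + i = n - 1)%N by rewrite addnC.
rewrite /coord_form !tensor_coord_conv // !tensor_coord_cat.
rewrite (nakayama_swap nuP) gx -iterS.
have -> : (n - 2).+1 = (i + j)%N by rewrite ij -subSn.
by rewrite iterD -(iter_nakayamaM lamF nuP) (iter_nakayama_form nuP).
Qed.

End FrobeniusCase.

Theorem theoremD (K : fieldType) (R : falgType K) (n : nat)
    (n_gt1 : (1 < n)%N) (phi : assoc_morph (dual_bimod R) n) :
  (bimod_iso (tpow (dual_bimod R) (n - 2)) (reg_bimod R) ->
     symmetric_alg (factor_alg n_gt1 phi))
  /\
  (frobenius R ->
     [/\ graded_frobenius (factor_grading n_gt1 phi) ((n - 1)%:R : 'Z_n),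
         frobenius (factor_alg n_gt1 phi)
       & forall (lambda : dual R) (nu : 'End(R)),
           frobenius_form lambda -> nakayama lambda nu ->
           exists Lambda : dual (factor_alg n_gt1 phi),
             [/\ induced_form lambda nu Lambda,
                 forall Lambda', induced_form lambda nu Lambda' ->
                   Lambda' = Lambda,
                 frobenius_form Lambda
               & exists N : factor_alg n_gt1 phi -> factor_alg n_gt1 phi,
                 [/\ nakayama Lambda N,
                     forall N', nakayama Lambda N' -> N' =1 N,
                     forall (i : nat) (r : 'I_i -> R), (1 <= i <= n - 1)%N ->
                       N (lam_tensor n_gt1 phi lambda r) =
                       lam_tensor n_gt1 phi lambda
                         (fun k => iter (n - 2) (nu^-1)%VF (r k))
                   & forall r : R,
                       N (fhom n_gt1 phi (r : tpow (dual_bimod R) 0)) =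
                       fhom n_gt1 phi
                         (iter (n - 2) (nu^-1)%VF r : tpow (dual_bimod R) 0)]]]).
Proof.
split=> [|RF].
  case: n n_gt1 phi => [|[|k]] // k_gt1 psi; rewrite !subSS subn0.
  case=> theta theta_morph [thetaV thetaK thetaVK].
  exact: factor_alg_symmetric theta_morph thetaK thetaVK k_gt1 psi.
have [Lam LamF Lam0] : exists2 Lam : dual (factor_alg n_gt1 phi),
    frobenius_form Lam & forall i : 'Z_n, i != (n - 1)%:R ->
      forall x, x \in factor_grading n_gt1 phi i -> Lam x = 0.
  have [lam lamF] := frobenius_has_form RF.
  have [nu nuP] := nakayama_exists lamF.
  have [c c_morph [cK Kc]] := frobenius_form_iso lamF.
  exists (twisted_form lam nu c_morph n_gt1 phi).
    exact: twisted_form_frobenius.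
  by have [] := twisted_form_induced lamF nuP c_morph cK Kc n_gt1 phi.
split.
- exact: graded_frobenius_of_form LamF Lam0.
- exact: frobenius_of_form LamF.
clear Lam LamF Lam0.
move=> lambda nu lamF nuP; have [c c_morph [cK Kc]] := frobenius_form_iso lamF.
have LamF : frobenius_form (twisted_form lambda nu c_morph n_gt1 phi).
  exact: twisted_form_frobenius.
exists (twisted_form lambda nu c_morph n_gt1 phi); split=> //.
- exact: twisted_form_induced.
- by move=> Lambda'; apply: induced_form_unique.
have [N NP] := nakayama_exists LamF; exists N; split=> //.
- by move=> N' N'P; apply: (nakayama_uniq LamF).
- move=> i r /andP[_ li].
  have lin : (i < n)%N by rewrite (leq_ltn_trans li) // subn1 prednK // ltnW.
  apply: (twisted_form_nakayama lamF nuP cK Kc lin NP).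
  rewrite !(tensor_coord_tprod lamF nuP c_morph cK Kc).
  rewrite (big_morph _ (iter_nakayamaM lamF nuP _) (iter_nakayama1 lamF nuP _)).
  apply: eq_bigr => k _.
  by rewrite -iterD addnC iterD (iter_nakayamaK lamF nuP).
- move=> r; apply: (twisted_form_nakayama lamF nuP cK Kc _ NP).
    exact: ltnW.
  by rewrite /= (iter_nakayamaK lamF nuP).
Qed.
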